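(* Let $X=(X_1,\ldots,X_n)'$ be an $n$-dimensional Lévy process such that: (D) $X_k(t)\to-\infty$ almost surely as $t\to\infty$, for every $k=1,\ldots,n$; (G) for $j=1,\ldots,n-1$, $X_{j+1}(t)=K_{j+1}X_j(t)+\Upsilon_{j+1}(t)$, where $K_2,\ldots,K_n$ are strictly positive constants, $\Upsilon_2,\ldots,\Upsilon_n$ are nonnegative subordinators, and $X_1,\Upsilon_2,\ldots,\Upsilon_n$ are mutually independent. Then for any $\alpha,\beta\in\mathbb R_+^n$, \[ \mathbb E\, e^{-\langle\alpha,G\rangle-\langle\beta,\overline X\rangle} =\prod_{j=1}^{n-1}\frac{\mathbb E\exp\Big(-\Big[\sum_{\ell=j}^n\alpha_\ell+\sum_{\ell=j+1}^n\theta_\ell^\Upsilon\big(\sum_{k=\ell}^nK_\ell^k\beta_k\big)\Big]G_j-\Big[\sum_{\ell=j}^nK_j^\ell\beta_\ell\Big]\overline X_j\Big)}{\mathbb E\exp\Big(-\Big[\sum_{\ell=j+1}^n\alpha_\ell+\sum_{\ell=j+1}^n\theta_\ell^\Upsilon\big(\sum_{k=\ell}^nK_\ell^k\beta_k\big)\Big]G_j-\Big[\sum_{\ell=j+1}^nK_j^\ell\beta_\ell\Big]\overline X_j\Big)}\;\times\;\mathbb E\,e^{-\alpha_nG_n-\beta_n\overline X_n}. \]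
   Context: A Lévy process is a càdlàg process with stationary independent increments started at $0$. Notation: $\overline X_k=\sup_{t\ge0}X_k(t)$ and $\overline X=(\overline X_1,\ldots,\overline X_n)'$; $G_k=\inf\{t\ge0: X_k(t)=\overline X_k\text{ or }X_k(t-)=\overline X_k\}$ and $G=(G_1,\ldots,G_n)'$ (these are almost surely finite under (D)). For $1\le j\le\ell\le n$, $K_j^\ell=\prod_{i=j+1}^\ell K_i$, with $K_j^j=1$. For $j=2,\ldots,n$ and $\beta\ge0$, $\theta_j^\Upsilon(\beta)=-\log\mathbb E\,e^{-\beta\Upsilon_j(1)}$. $\langle\cdot,\cdot\rangle$ is the scalar product on $\mathbb R^n$. *)

(* Defs.v *)
From HB Require Import structures.
From mathcomp Require Import all_boot all_order all_algebra.
From mathcomp Require Import all_classical all_reals all_analysis.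

Set Implicit Arguments.
Unset Strict Implicit.
Unset Printing Implicit Defensive.

Import Order.TTheory GRing.Theory Num.Theory.
Import numFieldNormedType.Exports.

Local Open Scope classical_set_scope.
Local Open Scope ring_scope.

Definition borel (V : topologicalType) : set (set V) := <<s @open V >>.

(* Processes are indexed by the whole of [R]; only times [0 <= t] are ever
   constrained or used. *)

(* Path functionals. [sup] and [inf] are the real-valued ones of the library
   (equal to 0 on an unbounded or empty set); for a path tending to -oo, the
   supremum is finite, and it is attained or approached from the left. *)
Definition path_sup (R : realType) (x : R -> R) : R :=
  sup [set x t | t in [set t | 0 <= t]].

(* A left limit is considered only at t > 0, following x(0-) = x(0). *)
Definition path_argsup (R : realType) (x : R -> R) : R :=
  inf [set t | 0 <= t /\
    (x t = path_sup x \/ (0 < t /\ x s @[s --> t^'-] --> path_sup x))].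

Definition cadlag (R : realType) (V : normedModType R) (x : R -> V) : Prop :=
  (forall t, 0 <= t -> x s @[s --> t^'+] --> x t) /\
  (forall t, 0 < t -> exists l : V, x s @[s --> t^'-] --> l).

Section processes.
Context (d : measure_display) (T : measurableType d) (R : realType)
        (P : probability T R).

Definition mutually_independent (I : finType) (F : I -> set (set T)) : Prop :=
  forall (J : {set I}) (A : I -> set T), (forall i, i \in J -> F i (A i)) ->
  P (\bigcap_(i in [set` J]) A i) = (\prod_(i in J) P (A i))%E.

Definition sigma_rv (V : topologicalType) (Y : T -> V) : set (set T) :=
  preimage_set_system setT Y (@borel V).

Definition sigma_process (V : topologicalType) (Y : R -> T -> V) :
    set (set T) :=
  <<s \bigcup_(t in [set t | 0 <= t]) sigma_rv (Y t) >>.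

Record levy_process (V : normedModType R) (Y : R -> T -> V) : Prop := {
  levy_measurable : forall t, 0 <= t -> sigma_rv (Y t) `<=` measurable;
  levy_start : {ae P, forall w, Y 0 w = 0};
  levy_cadlag : {ae P, forall w, cadlag (fun t => Y t w)};
  levy_stationary : forall s t (B : set V), 0 <= s -> s <= t -> borel B ->
    P [set w | B (Y t w - Y s w)] = P [set w | B (Y (t - s) w)];
  levy_independent : forall (m : nat) (t : nat -> R),
    0 <= t 0%N -> (forall i, t i <= t i.+1) ->
    mutually_independent
      (fun i : 'I_m => sigma_rv (fun w => Y (t i.+1) w - Y (t i) w)) }.

Definition subordinator (Y : R -> T -> R) : Prop :=
  levy_process (Y : R -> T -> R^o) /\
  {ae P, forall w, forall s t, 0 <= s -> s <= t -> Y s w <= Y t w}.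

(* Only used on functions with values a.s. in (0, 1], so [fine] loses nothing. *)
Definition EE (f : T -> R) : R := fine ('E_P[f])%E.

Definition theta (Y : R -> T -> R) (b : R) : R :=
  - ln (EE (fun w => expR (- (b * Y 1 w)))).

End processes.

(* Coordinates 1, ..., n.+1 are represented by 0, ..., n in ['I_n.+1]. *)
Definition Kprod (R : realType) (n : nat) (K : 'I_n.+1 -> R)
    (j l : 'I_n.+1) : R :=
  \prod_(i < n.+1 | (j < i <= l)%N) K i.

(* Main.v *)
(** Each X_l with l >= j is an increasing transform of X_j plus independent
subordinators, so it peaks after X_j does. For a random walk, cutting the path
at the first maximum of the j-th coordinate makes the part before and the part
after independent: the joint law is a sum over k of (first k steps with a
strict record at k) times (fresh walk staying below 0). Hence E[f g] E[f'] =
E[f'g] E[f] when f, f' depend on the part before and g on the part after, while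
E[f] reduces to a functional of X_j alone because the subordinators, evaluated
at the peak of the independent X_j, contribute their Laplace exponents. With
f, f' the weights with and without (alpha_j, beta_j) this gives one factor of
the product, and the product telescopes.

The Levy process is reached through its skeletons of step 2^-q. The supremum
may be attained several times, and then grid maximizers need not converge to
the first one; subtracting from X_l the drift K_1^l t / (m+1), which preserves
the network structure, forces this convergence in the iterated limit q, then
m. All discrete quantities only involve grid maximizers and maxima, so nothing
has to be said about the subordinators at the random time G_j. *)

Require Import Defs.
From HB Require Import structures.
From mathcomp Require Import all_boot all_order all_algebra.
From mathcomp Require Import all_classical all_reals all_analysis.
From mathcomp Require Import measurable_realfun ring lra.

Set Implicit Arguments.
Unset Strict Implicit.
Unset Printing Implicit Defensive.

Import Order.TTheory GRing.Theory Num.Theory.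
Import numFieldNormedType.Exports.

Local Open Scope classical_set_scope.
Local Open Scope ring_scope.

(** * Suprema of cadlag paths *)

(** The walk after [k] steps has the law of the whole walk, so the factor after the cut is the same
    for every [k] and comes out of the sum. In a product of two discrete expectations these factors
    may therefore be exchanged. It is this product identity that passes to the limit; the quotient
    is formed only there, where the denominator is shown to be positive. An obstacle is the discrete
    expectation whose weights after the cut are dropped: it still charges the values of the higher
    coordinates at the peak of coordinate j, and these do not converge to suprema. They are
    integrated out on the grid, where for fixed [k] the time is deterministic and dyadic. Hence
    Laplace exponents are needed at dyadic times only, and there multiplicativity alone gives them.
    The mesh needed for a given accuracy depends on the tilt, so the two limits are never merged,
    and expectations follow by Fatou's lemma applied twice. The limiting variables are not known to
    be measurable; iterated lower limits of the skeletons provide measurable versions. *)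

(* Compactness of [0, b] for upper bounds taken in a directed set D: with D
   the reals this gives boundedness, with D = {c < sup} attainment. *)
Lemma local_bound (R : realType) (x : R -> R) (b : R) (D : set R) :
  (forall c c', D c -> D c' -> D (Num.max c c')) -> 0 <= b ->
  (forall a : R, 0 <= a <= b -> exists2 c : R, D c & exists2 eta : R, 0 < eta &
     forall t : R, 0 <= t -> `|t - a| < eta -> x t <= c) ->
  exists2 c : R, D c & forall t : R, 0 <= t <= b -> x t <= c.
Proof.
move=> Dmax b0 loc.
(* [A] collects the horizons up to which one bound from [D] works; the local bound at [sup A] pushes
   past [sup A] unless [b] has been reached. *)
pose A := [set t : R | 0 <= t <= b /\
  exists2 c : R, D c & forall s : R, 0 <= s <= t -> x s <= c].
have A0 : A 0.
  split; first by rewrite lexx.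
  have [|c Dc [e e0 ec]] := loc 0; first by rewrite lexx.
  exists c => // s /andP[s0 s0']; have -> : s = 0 by apply/eqP; rewrite eq_le s0 s0'.
  by apply: ec => //; rewrite subrr normr0.
have supA : has_sup A.
  by split; [exists 0|exists b => t [/andP[]]].
have s0 : 0 <= sup A by apply: ub_le_sup => //; case: supA.
have sb : sup A <= b by apply: ge_sup; [exists 0|move=> t [/andP[]]].
have [|c Dc [e e0 ec]] := loc (sup A); first by rewrite s0.
have [t [/andP[t0 tb] [c' Dc' c'P]] tA] := sup_adherent e0 supA.
pose r := Num.min b (sup A + e / 2).
have e20 : 0 < e / 2 by rewrite divr_gt0.
have r0 : 0 <= r by rewrite le_min b0 addr_ge0// ltW.
have rb : r <= b by rewrite ge_min lexx.
have rA : r <= sup A + e / 2 by rewrite ge_min lexx orbT.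
have bnd s : 0 <= s <= r -> x s <= Num.max c c'.
  move=> /andP[s0' sr]; have [st|st] := leP s t.
    by rewrite le_max c'P ?orbT ?s0'.
  rewrite le_max ec// ltr_norml; apply/andP; split; lra.
have : r <= sup A.
  apply: ub_le_sup; first by case: supA.
  split; first by rewrite r0.
  by exists (Num.max c c'); [exact: Dmax|].
rewrite /r ge_min leNgt; case/orP => [bA|]; last by lra.
exists (Num.max c c'); first exact: Dmax.
move=> s /andP[s0' sb']; apply: bnd; rewrite s0' /r le_min sb'/=.
have : b <= sup A by rewrite leNgt.
lra.
Qed.

(** Right continuity bounds [x] from [a] on, the left limit bounds it before [a], and the larger
    bound is still below [S]. With [S] arbitrary it serves for boundedness, with [S] the supremum
    for attainment. *)
Lemma cadlag_local_lt (R : realType) (x : R -> R) (a S : R) :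
  0 <= a -> x s @[s --> a^'+] --> x a -> x a < S ->
  (0 < a -> exists2 l : R, l < S & x s @[s --> a^'-] --> l) ->
  exists2 c : R, c < S & exists2 eta : R, 0 < eta &
     forall t : R, 0 <= t -> `|t - a| < eta -> x t <= c.
Proof.
move=> a0 xr xS xl.
have [c1 c1S [e1 e10 h1]] : exists2 c : R, c < S & exists2 eta : R, 0 < eta &
     forall t : R, a <= t -> `|t - a| < eta -> x t <= c.
  have [c xc cS] : exists2 c : R, x a < c & c < S by exists ((x a + S) / 2); lra.
  have := cvgr_lt _ xr c xc; rewrite near_withinE => -[/= e e0 he].
  exists c => //; exists e => // t; rewrite le_eqVlt => /orP[/eqP <- _|at_ te].
    exact: ltW.
  by apply/ltW/he => //=; rewrite distrC.
move: a0; rewrite le_eqVlt => /orP[/eqP a0|a0].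
  by exists c1 => //; exists e1 => // t t0; apply: h1; rewrite -a0.
have [l lS ll] := xl a0.
have [c2 c2S [e2 e20 h2]] : exists2 c : R, c < S & exists2 eta : R, 0 < eta &
     forall t : R, t < a -> `|t - a| < eta -> x t <= c.
  have [c xc cS] : exists2 c : R, l < c & c < S by exists ((l + S) / 2); lra.
  have := cvgr_lt _ ll c xc; rewrite near_withinE => -[/= e e0 he].
  by exists c => //; exists e => // t ta te; apply/ltW/he => //=; rewrite distrC.
exists (Num.max c1 c2); first by rewrite gt_max c1S.
exists (Num.min e1 e2); first by rewrite lt_min e10.
move=> t t0; rewrite lt_min => /andP[te1 te2].
by rewrite le_max; have [at_|ta] := leP a t; apply/orP; [left; exact: h1|right; exact: h2].
Qed.

(** The strict inequality at [a] matters: neighbourhoods in [a^'+] leave out [a] itself. *)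
Lemma near_dyadic_right (R : realType) (a e : R) : 0 <= a -> 0 < e ->
  \forall q \near \oo, exists i : nat, a < i%:R / 2 ^+ q < a + e.
Proof.
move=> a0 e0.
have h : (fun q : nat => (2^-1 : R) ^+ q) @ \oo --> 0.
  apply: (@cvg_expr R 2^-1).
  rewrite ger0_norm ?invr_ge0//.
  by rewrite invf_lt1 ?ltr1n.
apply: (filterS _ (cvgr_lt _ h e e0)) => q hq.
have q0 : 0 < 2 ^+ q :> R by rewrite exprn_gt0.
have hq' : 1 < e * 2 ^+ q.
  by move: hq; rewrite exprVn -[X in X < _ -> _]mul1r ltr_pdivrMr.
(* The first grid point strictly beyond [a], at distance at most 2^-q from it. *)
exists (Num.truncn (a * 2 ^+ q)).+1.
have /andP[h1 h2] := truncn_itv (mulr_ge0 a0 (ltW q0)).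
rewrite ltr_pdivlMr// ltr_pdivrMr// h2 /= -natr1 mulrDl.
lra.
Qed.

Lemma near_dyadic_left (R : realType) (a e : R) : 0 < a -> 0 < e ->
  \forall q \near \oo, exists i : nat, a - e < i%:R / 2 ^+ q < a.
Proof.
move=> a0 e0.
(* The version on the right is applied at [a - d], which must be nonnegative; its window then ends
   exactly at [a]. *)
pose d : R := Num.min a e / 2.
have d0 : 0 < d by rewrite divr_gt0// lt_min a0.
have da : d <= a / 2 by rewrite ler_pM2r ?invr_gt0// ge_min lexx.
have de : d <= e / 2 by rewrite ler_pM2r ?invr_gt0// ge_min lexx orbT.
have ad0 : 0 <= a - d by lra.
apply: (filterS _ (near_dyadic_right ad0 d0)) => q [i hi].
by exists i; lra.
Qed.

Lemma cvgNy_lt (R : realType) (x : R -> R) (c : R) :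
  x t @[t --> +oo] --> -oo -> exists2 b : R, 0 <= b & forall t : R, b <= t -> x t < c.
Proof.
move=> /cvgrNyPlt/(_ c); case=> M [_ hM].
exists (Num.max 0 M + 1); first by rewrite addr_ge0// le_max lexx.
move=> t h; apply: hM; apply: lt_le_trans h.
by rewrite ltr_pwDr// le_max lexx orbT.
Qed.

Section path.
Context {R : realType} (x : R -> R).
Hypotheses (cx : cadlag (x : R -> R^o)) (xoo : x t @[t --> +oo] --> -oo).

Let S := path_sup x.
Let G := path_argsup x.

(** The set whose infimum is [path_argsup x]. The infimum is not shown to belong to it;
    approximation from above suffices. *)
Definition near_maximal (t : R) : Prop :=
  0 <= t /\ (x t = S \/ (0 < t /\ x s @[s --> t^'-] --> S)).

Lemma path_bounded : exists C : R, forall t : R, 0 <= t -> x t <= C.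
Proof.
have [b b0 hb] := @cvgNy_lt R x 0 xoo.
have [//|//||c _ hc] := @local_bound R x b setT.
  move=> a /andP[a0 _]; have [xr xl] := cx.
  have [l hl] : exists l : R, 0 < a -> x s @[s --> a^'-] --> l.
    case: (ltP 0 a) => [a0'|_]; last by exists 0.
    by have [l hl] := xl a a0'; exists l.
  have [|| c _ h] := @cadlag_local_lt R x a (Num.max (x a) l + 1) a0 (xr a a0).
  - by rewrite ltr_pwDr// le_max lexx.
  - by move=> a0'; exists l; [rewrite ltr_pwDr// le_max lexx orbT|exact: hl].
  - by exists c.
exists (Num.max c 0) => t t0; have [tb|bt] := leP t b.
  by rewrite le_max hc ?t0.
by rewrite le_max (ltW (hb _ (ltW bt))) orbT.
Qed.

Lemma path_has_sup : has_sup [set x t | t in [set t | 0 <= t]].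
Proof.
split; first by exists (x 0), 0 => /=.
by have [C hC] := path_bounded; exists C => _ [t t0 <-]; exact: hC.
Qed.

Lemma path_sup_ub t : 0 <= t -> x t <= S.
Proof. by move=> t0; apply: ub_le_sup; [case: path_has_sup|exists t]. Qed.

Lemma path_sup_approx e : 0 < e -> exists2 t : R, 0 <= t & S - e < x t.
Proof.
by move=> e0; have [_ [t t0 <-] h] := sup_adherent e0 path_has_sup; exists t.
Qed.

(** By contraposition: if no point of [0, b] is near-maximal, each has a neighbourhood where [x] is
    at most some c < S, and compactness in the directed set {c < S} gives a single c < S on all of
    [0, b]. *)
Lemma near_maximal_ex b : 0 <= b ->
  (forall c : R, c < S -> exists2 t : R, 0 <= t <= b & c < x t) ->
  exists2 a : R, a <= b & near_maximal a.
Proof.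
move=> b0 hb; apply: contrapT => /forall2NP nm.
have [||c cS hc] := @local_bound R x b [set c | c < S] _ b0.
- by move=> c c' /= cS c'S; rewrite gt_max cS.
- move=> a /andP[a0 ab]; case: (nm a) => [//|nma].
  have [xr xl] := cx; apply: cadlag_local_lt => //; first exact: xr.
    rewrite lt_neqAle path_sup_ub// andbT; apply/eqP => xaS.
    by apply: nma; split => //; left.
  move=> a0'; have [l hl] := xl a a0'; exists l => //.
  rewrite lt_neqAle; apply/andP; split.
    by apply/eqP => lS; apply: nma; split => //; right; rewrite -lS.
  apply: (cvgr_to_le hl); near=> s; apply: path_sup_ub.
  by near: s; exact: nbhs_left_ge.
- by have [t tb ct] := hb _ cS; have := hc t tb; rewrite leNgt ct.
Unshelve. all: by end_near. Qed.

Lemma near_maximal_inf a : near_maximal a -> G <= a.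
Proof. by move=> aM; apply: ge_inf => //; exists 0 => t []. Qed.

Lemma near_maximal_approx e : 0 < e -> exists2 a : R, a < G + e & near_maximal a.
Proof.
move=> e0.
have [b b0 hb] := cvgNy_lt (S - 1) xoo.
have [c cS|a _ aM] := near_maximal_ex b0.
  (* The term 1 forces the approximating time to lie before [b], since the path is below S - 1 from
     [b] on; the term [S - c] makes its value exceed [c]. *)
  have S0 : 0 < Num.min 1 (S - c) :> R by rewrite lt_min ltr01 subr_gt0.
  have [t t0 ht] := path_sup_approx S0.
  have h1 : Num.min 1 (S - c) <= 1 by rewrite ge_min lexx.
  have h2 : Num.min 1 (S - c) <= S - c by rewrite ge_min lexx orbT.
  exists t; last by lra.
  by rewrite t0 leNgt; apply/negP => /ltW/hb; lra.
have hinf : has_inf [set t | near_maximal t].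
  by split; [exists a|exists 0 => t []].
by have [a' a'M a'G] := inf_adherent e0 hinf; exists a'.
Qed.

Lemma path_argsup_ge0 : 0 <= G.
Proof.
have [a _ aM] := near_maximal_approx ltr01.
by apply: lb_le_inf; [exists a|move=> t []].
Qed.

(** An attained supremum is approached along grid points to the right, by right continuity; one that
    is only a left limit, along grid points to the left. *)
Lemma near_maximal_dyadic a e d : near_maximal a -> 0 < e -> 0 < d ->
  \forall q \near \oo, exists2 i : nat,
    `|i%:R / 2 ^+ q - a| < d & S - e < x (i%:R / 2 ^+ q).
Proof.
move=> [a0 [xaS|[a0' xl]]] e0 d0.
- have eS : S - e < x a by lra.
  have [xr _] := cx.
  have := cvgr_gt _ (xr a a0) _ eS; rewrite near_withinE => -[/= r r0 hr].
  have : 0 < Num.min r d by rewrite lt_min r0.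
  move=> rd0; apply: (filterS _ (near_dyadic_right a0 rd0)) => q [i /andP[h1]].
  rewrite -ltrBlDl lt_min => /andP[h2 h3]; exists i.
    by rewrite gtr0_norm// subr_gt0.
  by apply: hr => //=; rewrite distrC gtr0_norm// subr_gt0.
- have eS : S - e < S by lra.
  have := cvgr_gt _ xl _ eS; rewrite near_withinE => -[/= r r0 hr].
  have : 0 < Num.min r d by rewrite lt_min r0.
  move=> rd0; apply: (filterS _ (near_dyadic_left a0' rd0)) => q [i /andP[h1 h2]].
  have {h1} : a - i%:R / 2 ^+ q < Num.min r d by lra.
  rewrite lt_min => /andP[h3 h4]; exists i.
    by rewrite distrC gtr0_norm// subr_gt0.
  by apply: hr => //=; rewrite gtr0_norm// subr_gt0.
Qed.

(* Comparing the grid maximizer t with a grid point t' near the first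
   near-maximizer gives c' (t - t') <= S - x t', hence t <= G + e however small
   the tilt c' is; the lower bound needs the tilt to be small. *)
Lemma skeleton_argmax_cvg (c e : R) : 0 < c -> 0 < e ->
  \forall m \near \oo, \forall q \near \oo, forall i : nat,
    (forall k : nat, x (k%:R / 2 ^+ q) - c / m.+1%:R * (k%:R / 2 ^+ q) <=
                     x (i%:R / 2 ^+ q) - c / m.+1%:R * (i%:R / 2 ^+ q)) ->
    `|i%:R / 2 ^+ q - G| <= e /\
    `|x (i%:R / 2 ^+ q) - c / m.+1%:R * (i%:R / 2 ^+ q) - S| <= e.
Proof.
move=> c0 e0.
(* A gap below [S] up to time G - e: without it [near_maximal_ex] would give a near-maximal point
   below the infimum [G]. *)
have [C CS hC] : exists2 C : R, C < S & forall t : R, 0 <= t -> t <= G - e -> x t <= C.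
  have [Ge|Ge] := ltP (G - e) 0.
    by by exists (S - 1) => [|t t0 tG]; lra.
  apply: contrapT => /forall2NP nC.
  have [C CS|a aG aM] := near_maximal_ex Ge.
    case: (nC C) => // /existsNP[t] /not_implyP[t0] /not_implyP[tG] /negP.
    by rewrite -ltNge => ht; exists t => //; rewrite t0.
  by have := near_maximal_inf aM; lra.
(* A third of the gap: one [k] is lost by the path value at [i1] and one by the tilt there, so the
   grid maximum still exceeds [C]. *)
pose k : R := Num.min (S - C) e / 3.
have k0 : 0 < k by rewrite divr_gt0// lt_min subr_gt0 CS.
have kC : k <= (S - C) / 3 by rewrite ler_pM2r ?invr_gt0// ge_min lexx.
have ke : k <= e / 3 by rewrite ler_pM2r ?invr_gt0// ge_min lexx orbT.
have G0 := path_argsup_ge0.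
(* G + 2 bounds the time of the grid point [i1], chosen within 1 of a near-maximal point [a1] < G +
   1. *)
have cvg0 : (fun m : nat => c * (G + 2) * m.+1%:R^-1) @ \oo --> c * (G + 2) * 0.
  by apply: cvgMr; exact: cvg_harmonic.
rewrite mulr0 in cvg0.
apply: (filterS _ (cvgr_lt _ cvg0 _ k0)) => m hm.
have cm0 : 0 < c / m.+1%:R by rewrite divr_gt0.
set c' : R := c / m.+1%:R in cm0 *.
have {}hm : c' * (G + 2) < k by rewrite /c' mulrAC.
have [a1 a1G a1M] := near_maximal_approx ltr01.
have e3 : 0 < e / 3 by rewrite divr_gt0.
have [a2 a2G a2M] := near_maximal_approx e3.
near=> q => i hi.
have dy0 (j : nat) : 0 <= j%:R / 2 ^+ q :> R by rewrite divr_ge0// exprn_ge0.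
have [i1 h1 h1'] : exists2 i : nat,
    `|i%:R / 2 ^+ q - a1| < 1 & S - k < x (i%:R / 2 ^+ q).
  by near: q; exact: near_maximal_dyadic.
(* This tolerance shrinks with the tilt [c'], hence with [m]; therefore [q] has to be chosen after
   [m]. *)
have [i2 h2 h2'] : exists2 i : nat,
    `|i%:R / 2 ^+ q - a2| < e / 3 & S - c' * (e / 3) < x (i%:R / 2 ^+ q).
  by near: q; apply: near_maximal_dyadic => //; rewrite mulr_gt0.
have := hi i1; have := hi i2.
move: (dy0 i) (dy0 i1) (dy0 i2) h1 h1' h2 h2'.
move: (_ / _) => t; move: (_ / _) => t1; move: (_ / _) => t2.
move=> t0 t10 t20 h1 h1' h2 h2' m2 m1.
rewrite !ltr_norml in h1 h2.
have xtS := path_sup_ub t0.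
have tG : t <= G + e.
  have : c' * t <= c' * (t2 + e / 3) by lra.
  by rewrite ler_pM2l// => ?; lra.
have t1G : c' * t1 < k.
  by apply: le_lt_trans hm; rewrite ler_pM2l//; lra.
have ct0 : 0 <= c' * t by rewrite mulr_ge0// ltW.
have Gt : G - e < t by rewrite ltNge; apply/negP => /(hC _ t0); lra.
by rewrite !ler_norml; split; lra.
Unshelve. all: by end_near. Qed.

End path.

(** * First maximum of a walk *)

Section discrete.
Context {R : realType}.
Implicit Types (s : nat -> R) (N k : nat).

(** The strict test keeps the earliest maximizer, so the argmax is a strict record. *)
Fixpoint argmaxn s N : nat :=
  if N is N'.+1 then
    if s (argmaxn s N') < s N then N else argmaxn s N'
  else 0%N.

Lemma le_argmaxn s N k : (k <= N)%N -> s k <= s (argmaxn s N).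
Proof.
elim: N => [|N IH] /=; first by rewrite leqn0 => /eqP ->.
rewrite leq_eqVlt => /orP[/eqP -> |kN].
  by case: ltP.
by case: ltP => [/ltW|_]; [apply: le_trans|]; exact: IH.
Qed.

Lemma lt_argmaxn s N k : (k < argmaxn s N)%N -> s k < s (argmaxn s N).
Proof.
elim: N => [//|N IH] /=; case: ltP => [h|_]; last exact: IH.
by rewrite ltnS => /(le_argmaxn s)/le_lt_trans; exact.
Qed.

(** [strict_record] involves only the first [k] steps and [peak] only the increments after [k],
    which is what makes the two parts independent. Being strict before and weak after selects one
    index among ties. *)
Definition strict_record s k := [forall i : 'I_k, s i < s k].
Definition peak N s k := [forall i : 'I_N.+1, s (k + i)%N <= s k].
Definition summit N s k := strict_record s k && peak N s k.

Lemma summit_lt N s k k' : (k < k')%N -> (k' <= k + N)%N ->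
  peak N s k -> strict_record s k' -> False.
Proof.
move=> kk' kN /forallP pk /forallP rk'.
have k'k : (k' - k < N.+1)%N by rewrite ltnS leq_subLR.
have := pk (Ordinal k'k); rewrite /= subnKC; last exact: ltnW.
by rewrite leNgt; have /= -> := rk' (Ordinal kk').
Qed.

Lemma summit_inj N s (k k' : 'I_N) : summit N s k -> summit N s k' -> k = k'.
Proof.
move=> /andP[rk pk] /andP[rk' pk']; apply/val_inj/eqP.
case: ltngtP => // lt; exfalso.
  by apply: (summit_lt lt) pk rk'; rewrite (leq_trans (ltnW (ltn_ord k')))// leq_addl.
by apply: (summit_lt lt) pk' rk; rewrite (leq_trans (ltnW (ltn_ord k)))// leq_addl.
Qed.

Lemma sum_summit N s (F : nat -> R) (k : 'I_N) : summit N s k ->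
  \sum_(i < N) (summit N s i)%:R * F i = F k.
Proof.
move=> sk; rewrite (bigD1 k)//= sk mul1r big1 ?addr0// => i ik.
case: (boolP (summit N s i)) => [si|_]; last by rewrite mul0r.
by rewrite (summit_inj si sk) eqxx in ik.
Qed.

Lemma sum_summit_itv N s (F : nat -> R) :
  (forall k, 0 <= F k <= 1) ->
  0 <= \sum_(i < N) (summit N s i)%:R * F i <= 1.
Proof.
move=> F01; case: (pickP (fun k : 'I_N => summit N s k)) => [k sk|ns].
  by rewrite (sum_summit F sk).
by rewrite big1 ?lexx ?ler01// => i _; rewrite ns mul0r.
Qed.

(** From [H] on the walk is below its starting value, so the maximum over [0, N] is global and its
    index is strictly below [N], hence among the summands of [split_fun]. *)
Lemma summit_argmaxn s N H : (0 < H <= N)%N ->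
  (forall i, (H <= i)%N -> s i < s 0%N) ->
  [/\ forall i, s i <= s (argmaxn s N), (argmaxn s N < N)%N &
      summit N s (argmaxn s N)].
Proof.
move=> /andP[H0 HN] neg; set t := argmaxn s N.
have s0t : s 0%N <= s t by exact: le_argmaxn.
have maxt i : s i <= s t.
  have [iN|Ni] := leqP i N; first exact: le_argmaxn.
  by apply/ltW/(lt_le_trans (neg i _)) => //; rewrite (leq_trans HN)// ltnW.
have tN : (t < N)%N.
  by rewrite ltnNge; apply/negP => Nt; move: s0t; rewrite leNgt neg// (leq_trans HN).
by split => //; apply/andP; split; apply/forallP => i; [exact: lt_argmaxn|exact: maxt].
Qed.

(** Three ranges: up to [t] values are at most [s t]; in the window of [N] steps after [t] the
    argmax wins; later the walk is below [s 0], itself at most [s t]. *)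
Lemma argmaxn_shift_max s N H t :
  (H <= N)%N -> (forall i, (H <= i)%N -> s i < s 0%N) ->
  (forall i, (i <= t)%N -> s i <= s t) ->
  forall i, s i <= s (t + argmaxn (fun i => (s (t + i)%N - s t)%R) N)%N.
Proof.
move=> HN neg st i; set r := argmaxn _ N.
have max_r k : (k <= N)%N -> s (t + k)%N <= s (t + r)%N.
  by move=> /(le_argmaxn (fun i => s (t + i)%N - s t)); rewrite lerD2r.
have s0r : s t <= s (t + r)%N by rewrite -[X in s X <= _]addn0 max_r.
have [it|ti] := leqP i t; first by rewrite (le_trans (st i it)).
have [iN|Ni] := leqP (i - t) N; first by rewrite -(subnKC (ltnW ti)) max_r.
rewrite ltW// (lt_le_trans (neg i _))//.
  by rewrite (leq_trans HN)// (leq_trans (ltnW Ni))// leq_subr.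
by rewrite (le_trans _ s0r)// st.
Qed.

End discrete.

(** * Expectations of possibly non-measurable functions *)

Section limn_einf_bounds.
Context {R : realType}.
Implicit Types (u : (\bar R)^nat) (c : \bar R).

Lemma limn_einf_ereal_sup u : limn_einf u = ereal_sup (range (einfs u)).
Proof. by rewrite limn_einf_lim; apply/cvg_lim => //; exact: cvg_einfs_sup. Qed.

Lemma lt_limn_einf u c : (c < limn_einf u)%E -> \forall n \near \oo, (c < u n)%E.
Proof.
rewrite limn_einf_ereal_sup => /ereal_sup_gt[_ [n _ <-] cn].
exists n => // m /= nm; apply: lt_le_trans cn _.
by apply: ereal_inf_lbound; exists m.
Qed.

Lemma limn_einf_ge u c : (\forall n \near \oo, (c <= u n)%E) -> (c <= limn_einf u)%E.
Proof.
move=> [n _ cu]; rewrite limn_einf_ereal_sup.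
apply: (@le_trans _ _ (einfs u n)); last by apply: ereal_sup_ubound; exists n.
by apply: le_ereal_inf_tmp => _ [m /= nm <-]; exact: cu.
Qed.

Lemma limn_einf_le u c : (\forall n \near \oo, (u n <= c)%E) -> (limn_einf u <= c)%E.
Proof.
move=> uc; rewrite leNgt; apply/negP => /lt_limn_einf cu.
have [n [h1 h2]] : exists n, (u n <= c)%E /\ (c < u n)%E.
  by apply: (@filter_ex _ \oo); apply: filterI.
by move: h2; rewrite ltNge h1.
Qed.

End limn_einf_bounds.

Section expectation.
Context {d : measure_display} {T : measurableType d} {R : realType}.
Variable P : probability T R.
Import HBNNSimple.

(* The suprema and their times are controlled only off a null set and P need
   not be complete, so f and g are not assumed measurable. *)
Lemma ge0_integral_le_ae (f g : T -> \bar R) :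
  (forall w, (0 <= f w)%E) -> (forall w, (0 <= g w)%E) ->
  {ae P, forall w, f w = g w} ->
  (\int[P]_w f w <= \int[P]_w g w)%E.
Proof.
move=> f0 g0 [N [mN N0 fgN]].
rewrite (ge0_integralTE P f0) (ge0_integralTE P g0).
apply: ge_ereal_sup => _ [h hf <-].
have mNc : measurable (~` N) by exact: measurableC.
(* Cutting the simple function off on a measurable null set that contains the exceptional points
   puts it below [g] everywhere and leaves its integral unchanged. *)
pose h' := proj_nnsfun h mNc.
have h'E w : h' w = h w * \1_(~` N) w by [].
apply: ereal_sup_ge; exists (sintegral P h').
  exists h' => // w; rewrite h'E indicE.
  case: (boolP (w \in ~` N)) => [wN|_]; last by rewrite mulr0.
  rewrite mulr1; apply: le_trans (hf w) _.
  suff -> : f w = g w by [].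
  by apply: contrapT => fg; move: wN; rewrite inE; apply; exact: fgN.
have E (k : {nnsfun T >-> R}) : sintegral P k = (\int[P]_w (k w)%:E)%E.
  by rewrite integral_nnsfun// patch_setT.
rewrite !E (ge0_ae_eq_integral (g := fun w => (h' w)%:E))//.
- exact/measurable_EFinP.
- by apply/measurable_EFinP; exact: measurable_funP.
- by move=> w _; rewrite lee_fin.
- by move=> w _; rewrite lee_fin.
exists N; split => // w /= /not_implyP[_].
apply: contra_notP => wN.
suff {1}-> : h w = h' w by [].
by rewrite h'E indicE mem_set// mulr1.
Qed.

Lemma EE_ae (f g : T -> R) : (forall w, 0 <= f w) -> (forall w, 0 <= g w) ->
  {ae P, forall w, f w = g w} -> EE P f = EE P g.
Proof.
move=> f0 g0 fg; rewrite /EE unlock; congr fine; apply/eqP; rewrite eq_le.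
by apply/andP; split; apply: ge0_integral_le_ae => //;
  apply: filterS fg => w ->.
Qed.

Definition unit_rv (f : T -> R) :=
  measurable_fun setT f /\ forall w, 0 <= f w <= 1.

Lemma unit_rv_ge0 f w : unit_rv f -> 0 <= f w.
Proof. by case=> _ /(_ w)/andP[]. Qed.

Lemma unit_rv_integrable f : unit_rv f -> P.-integrable setT (EFin \o f).
Proof.
move=> [mf f01]; apply: (@le_integrable _ _ _ P setT measurableT _ (cst 1%E)).
- exact/measurable_EFinP.
- move=> w _ /=; rewrite lee_fin normr1 ger0_norm; by case/andP: (f01 w).
- apply/integrableP; split => //; under eq_integral do rewrite /= normr1.
  by rewrite integral_cst//= probability_setT mule1 ltry.
Qed.

Lemma EE_fin f : unit_rv f -> (EE P f)%:E = (\int[P]_w (f w)%:E)%E.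
Proof.
by move=> uf; rewrite /EE unlock fineK// integrable_fin_num//; exact: unit_rv_integrable.
Qed.

Lemma unit_rvB f : unit_rv f -> unit_rv (fun w => 1 - f w).
Proof.
by case=> mf f01; split => [|w]; [exact: measurable_funB|have := f01 w; lra].
Qed.

Lemma unit_rvM f g : unit_rv f -> unit_rv g -> unit_rv (fun w => f w * g w).
Proof.
move=> [mf f01] [mg g01]; split => [|w]; first exact: measurable_funM.
have /andP[f0 f1] := f01 w; have /andP[g0 g1] := g01 w.
by rewrite mulr_ge0//= mulr_ile1.
Qed.

Lemma EE_1B f : unit_rv f -> EE P (fun w => 1 - f w) = 1 - EE P f.
Proof.
move=> uf; apply: EFin_inj; rewrite EE_fin; last exact: unit_rvB.
rewrite EFinB EE_fin//; under eq_integral do rewrite EFinB.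
rewrite integralB_EFin//; last exact: unit_rv_integrable.
  by rewrite integral_cst//= probability_setT mule1.
apply: (@unit_rv_integrable (cst 1)); split => // w.
by rewrite ler01 lexx.
Qed.

Lemma EE_sum (I : Type) (s : seq I) (f : I -> T -> R) :
  (forall i, unit_rv (f i)) ->
  EE P (fun w => \sum_(i <- s) f i w) = \sum_(i <- s) EE P (f i).
Proof.
move=> uf; rewrite {1}/EE unlock.
under eq_integral do rewrite -sumEFin.
rewrite ge0_integral_sum//; last 2 first.
- by move=> i; apply/measurable_EFinP; case: (uf i).
- by move=> i w _; rewrite lee_fin unit_rv_ge0.
have -> : (\sum_(i <- s) \int[P]_w (f i w)%:E = (\sum_(i <- s) EE P (f i))%:E)%E.
  by rewrite -sumEFin; apply: eq_bigr => i _; rewrite EE_fin.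
by [].
Qed.

Lemma EE_itv f : unit_rv f -> 0 <= EE P f <= 1.
Proof.
have ge0 g : unit_rv g -> 0 <= EE P g.
  move=> ug; rewrite -lee_fin EE_fin//; apply: integral_ge0 => w _.
  by rewrite lee_fin unit_rv_ge0.
move=> uf; rewrite ge0//= -subr_ge0 -EE_1B//; exact/ge0/unit_rvB.
Qed.

(** With zero mean the measurable version [f] would vanish almost everywhere, hence so would [g].
    This is what allows division by the denominators. *)
Lemma EE_gt0 (f g : T -> R) : unit_rv f -> (forall w, 0 < g w) ->
  {ae P, forall w, g w = f w} -> 0 < EE P g.
Proof.
move=> uf g0 gf; rewrite (EE_ae _ _ gf); last first.
- by move=> w; exact: unit_rv_ge0.
- by move=> w; exact: ltW.
rewrite lt_neqAle; apply/andP; split; last by case/andP: (EE_itv uf).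
apply/eqP => f0.
have : (\int[P]_(w in setT) `|(f w)%:E| = 0)%E.
  under eq_integral do rewrite gee0_abs ?lee_fin ?unit_rv_ge0//.
  by rewrite -EE_fin// -f0.
have /(ae_eq_integral_abs P measurableT)[h _] : measurable_fun setT (EFin \o f).
  by apply/measurable_EFinP; case: uf.
move=> /h fz; have : P setT = 0%E.
  have [N [mN N0 TN]] : {ae P, forall w, False}.
    apply: filterS2 gf fz => w gfw /(_ I) /= [f0w].
    by have := g0 w; rewrite gfw f0w ltxx.
  apply/eqP; rewrite eq_le measure_ge0 andbT -N0 le_measure ?inE//.
  by move=> w _; apply: TN => /=.
by rewrite probability_setT => -[]; apply/eqP; rewrite oner_eq0.
Qed.

(** An iterated limit, not a joint one: the rank from which [q] is large may depend on [m]. *)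
Definition iter_near (A : nat -> nat -> Prop) :=
  \forall m \near \oo, \forall q \near \oo, A m q.

(** The iterated lower limit of the [Q m q] is measurable with values in [0, 1], and it equals [Q0]
    wherever the convergence holds. *)
Lemma unit_rv_version (Q : nat -> nat -> T -> R) (Q0 : T -> R) :
  (forall m q, unit_rv (Q m q)) ->
  {ae P, forall w, forall e : R, 0 < e -> iter_near (fun m q => `|Q m q w - Q0 w| <= e)} ->
  exists2 Q1, unit_rv Q1 & {ae P, forall w, Q0 w = Q1 w}.
Proof.
move=> uQ cQ.
pose L w := limn_einf (fun m => limn_einf (fun q => (Q m q w)%:E)).
have mL : measurable_fun setT L.
  apply: measurableT_comp => //; apply: measurable_fun_limn_esup => m.
  apply: measurableT_comp => //; apply: measurableT_comp => //.
  apply: measurable_fun_limn_esup => q.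
  by apply: measurableT_comp => //; apply/measurable_EFinP; case: (uQ m q).
have L0 w : (0 <= L w)%E.
  apply: limn_einf_ge; apply: nearW => m; apply: limn_einf_ge; apply: nearW => q.
  by rewrite lee_fin unit_rv_ge0.
have L1 w : (L w <= 1)%E.
  apply: limn_einf_le; apply: nearW => m; apply: limn_einf_le; apply: nearW => q.
  by rewrite lee_fin; case: (uQ m q) => _ /(_ w)/andP[].
have Lf w : L w \is a fin_num.
  by rewrite ge0_fin_numE// (le_lt_trans (L1 w))// ltry.
exists (fun w => fine (L w)).
  split => [|w]; first exact: measurableT_comp.
  by rewrite -!lee_fin fineK// L0 L1.
apply: filterS cQ => w cw; apply: EFin_inj; rewrite fineK//.
apply/eqP; rewrite eq_le; apply/andP; split; apply/lee_addgt0Pr => e e0.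
  rewrite -leeBlDr//; apply: limn_einf_ge; apply: filterS (cw e e0) => m hm.
  apply: limn_einf_ge; apply: filterS hm => q; rewrite ler_norml => h.
  by rewrite -EFinB lee_fin; lra.
apply: limn_einf_le; apply: filterS (cw e e0) => m hm.
apply: limn_einf_le; apply: filterS hm => q; rewrite ler_norml => h.
by rewrite -EFinD lee_fin; lra.
Qed.

(** Fatou's lemma twice, first in [m] and then in [q] at fixed [m]. At fixed [m] the variables need
    not converge in [q], so lower limits replace limits. *)
Lemma EE_iter_lt (Q : nat -> nat -> T -> R) (Q0 : T -> R) (c : R) :
  (forall m q, unit_rv (Q m q)) -> unit_rv Q0 ->
  {ae P, forall w, forall e : R, 0 < e -> iter_near (fun m q => Q0 w - e <= Q m q w)} ->
  c < EE P Q0 -> iter_near (fun m q => c < EE P (Q m q)).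
Proof.
move=> uQ uQ0 cQ; rewrite -lte_fin EE_fin// => cQ0.
pose L m w := limn_einf (fun q => (Q m q w)%:E).
have mL m : measurable_fun setT (L m).
  apply: measurableT_comp => //; apply: measurable_fun_limn_esup => q.
  by apply: measurableT_comp => //; apply/measurable_EFinP; case: (uQ m q).
have mLL : measurable_fun setT (fun w => limn_einf (L ^~ w)).
  apply: measurableT_comp => //; apply: measurable_fun_limn_esup => m.
  exact: measurableT_comp.
have L0 m w : (0 <= L m w)%E.
  by apply: limn_einf_ge; apply: nearW => q; rewrite lee_fin unit_rv_ge0.
have : (\int[P]_w (Q0 w)%:E <= limn_einf (fun m => \int[P]_w L m w))%E.
  apply: le_trans (fatou P measurableT mL _); last by [].
  apply: ae_ge0_le_integral => //.
  - by move=> w _; rewrite lee_fin unit_rv_ge0.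
  - by apply/measurable_EFinP; case: uQ0.
  - by move=> w _; apply: limn_einf_ge; apply: nearW => m; exact: L0.
  apply: filterS cQ => w cw _; apply/lee_addgt0Pr => e e0.
  rewrite -leeBlDr//; apply: limn_einf_ge; apply: filterS (cw e e0) => m hm.
  by apply: limn_einf_ge; apply: filterS hm => q; rewrite -EFinB lee_fin.
move=> /(lt_le_trans cQ0)/lt_limn_einf; apply: filterS => m cm.
have : (\int[P]_w L m w <= limn_einf (fun q => \int[P]_w (Q m q w)%:E))%E.
  apply: fatou => // [q|q w _]; last by rewrite lee_fin unit_rv_ge0.
  by apply/measurable_EFinP; case: (uQ m q).
move=> /(lt_le_trans cm)/lt_limn_einf; apply: filterS => q.
by rewrite -EE_fin.
Qed.

(** The lower estimate for [Q] bounds the means from below; the same estimate for [1 - Q] bounds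
    them from above. *)
Lemma EE_iter_cvg (Q : nat -> nat -> T -> R) (Q0 : T -> R) (e : R) :
  (forall m q, unit_rv (Q m q)) -> (forall w, 0 <= Q0 w) ->
  {ae P, forall w, forall e : R, 0 < e -> iter_near (fun m q => `|Q m q w - Q0 w| <= e)} ->
  0 < e -> iter_near (fun m q => `|EE P (Q m q) - EE P Q0| <= e).
Proof.
move=> uQ Q00 cQ e0; have [Q1 uQ1 Q01] := unit_rv_version uQ cQ.
rewrite (EE_ae _ _ Q01)//; last by move=> w; exact: unit_rv_ge0.
have near_lo : iter_near (fun m q => EE P Q1 - e < EE P (Q m q)).
  apply: EE_iter_lt uQ uQ1 _ _; last by lra.
  apply: filterS2 cQ Q01 => w cw Q01w r /cw; apply: filterS => m.
  by apply: filterS => q; rewrite Q01w ler_norml; lra.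
have near_hi : iter_near (fun m q => 1 - EE P Q1 - e < EE P (fun w => 1 - Q m q w)).
  apply: (EE_iter_lt (Q0 := fun w => 1 - Q1 w)) => [m q|||].
  - exact: unit_rvB.
  - exact: unit_rvB uQ1.
  - apply: filterS2 cQ Q01 => w cw Q01w r /cw; apply: filterS => m.
    by apply: filterS => q; rewrite Q01w ler_norml; lra.
  - by rewrite EE_1B//; lra.
apply: filterS2 near_lo near_hi => m; apply: filterS2 => q.
by rewrite EE_1B// ler_norml; lra.
Qed.

End expectation.

(** * Independence *)

Section independence.
Context {d : measure_display} {T : measurableType d} {R : realType}.
Variable P : probability T R.

(** The last hypothesis packs two facts: [U] and [V] are independent, and [V] has the law of [V'].
    So the pair has a product law and Tonelli's theorem separates the integrals. *)
Lemma EE_mul_indep (U V V' : T -> R) :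
  unit_rv U -> unit_rv V -> unit_rv V' ->
  (forall A B : set R, measurable A -> measurable B ->
    P (U @^-1` A `&` V @^-1` B) = (P (U @^-1` A) * P (V' @^-1` B))%E) ->
  EE P (fun w => U w * V w) = EE P U * EE P V'.
Proof.
move=> uU uV uV' UV; have [mU _] := uU; have [mV _] := uV; have [mV' _] := uV'.
have mUV : measurable_fun setT (fun w => (U w, V w)) by exact: measurable_fun_pair.
pose Um : {mfun T >-> R} := HB.pack U (isMeasurableFun.Build _ _ _ _ _ mU).
pose Vm : {mfun T >-> R} := HB.pack V' (isMeasurableFun.Build _ _ _ _ _ mV').
pose UVm : {mfun T >-> (R * R)%type} :=
  HB.pack (fun w => (U w, V w)) (isMeasurableFun.Build _ _ _ _ _ mUV).
(* Tonelli's theorem wants an integrand that is nonnegative on the whole plane; [absn] is the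
   identity on the values of [U], [V] and [V']. *)
pose absn (x : R) := Num.max 0 x.
have mabs : measurable_fun setT absn by exact: measurable_maxr.
have absn0 x : 0 <= absn x by rewrite /absn le_max lexx.
have absU W w : unit_rv W -> absn (W w) = W w.
  by move=> uW; rewrite /absn max_r// unit_rv_ge0.
pose f (z : R * R) := (absn z.1 * absn z.2)%:E.
have mf : measurable_fun setT f.
  apply/measurable_EFinP; apply: measurable_funM.
    by apply: measurableT_comp => //; exact: measurable_fst.
  by apply: measurableT_comp => //; exact: measurable_snd.
have f0 z : (0 <= f z)%E by rewrite lee_fin mulr_ge0.
apply: EFin_inj; rewrite EE_fin; last exact: unit_rvM.
transitivity (\int[distribution P UVm]_z f z)%E.
  rewrite /distribution ge0_integral_pushforward//.
  by apply: eq_integral => w _; rewrite /= /f /= !absU.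
transitivity (\int[(distribution P Um \x distribution P Vm)%E]_z f z)%E.
  apply: eq_measure_integral => A mA _.
  by apply/esym/product_measure_unique => // B C mB mC; exact: UV.
rewrite fubini_tonelli1// /fubini_F /f /=.
under eq_integral => x _.
  under eq_integral do rewrite EFinM.
  rewrite ge0_integralZl//; last 3 first.
  - exact/measurable_EFinP.
  - by move=> y _; rewrite lee_fin.
  - by rewrite lee_fin.
  over.
rewrite /distribution ge0_integralZr//; last 3 first.
- exact/measurable_EFinP.
- by move=> y _; rewrite lee_fin.
- by apply: integral_ge0 => y _; rewrite lee_fin.
have int_abs (W : T -> R) (Wm : {mfun T >-> R}) : unit_rv W -> Wm =1 W ->
    (\int[pushforward P Wm]_x (absn x)%:E = (EE P W)%:E)%E.
  move=> uW WE; rewrite ge0_integral_pushforward//; last 2 first.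
  - exact/measurable_EFinP.
  - by move=> x _; rewrite lee_fin.
  by rewrite EE_fin//; apply: eq_integral => w _; rewrite /= WE absU.
by rewrite (int_abs U)// (int_abs V')// EFinM.
Qed.

(** Both sides are finite measures in [A] that agree on a pi-system containing the whole space.
    Allowing two maps [phi] and [psi] extends independence and equality in law together. *)
Lemma pi_ext (S : pointedType) (G : set (set S)) (phi psi : T -> S) (C D : set T) :
  setI_closed G -> G setT ->
  (forall A, G A -> measurable (phi @^-1` A)) ->
  (forall A, G A -> measurable (psi @^-1` A)) ->
  measurable C -> measurable D ->
  (forall A, G A -> P (phi @^-1` A `&` C) = (P D * P (psi @^-1` A))%E) ->
  forall A, <<s G >> A -> P (phi @^-1` A `&` C) = (P D * P (psi @^-1` A))%E.
Proof.
move=> GI GT mphi mpsi mC mD GE A sGA.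
have meas (h : T -> S) : (forall A, G A -> measurable (h @^-1` A)) ->
    measurable_fun setT (h : T -> g_sigma_algebraType G).
  move=> hG; apply: (@measurability _ _ T (g_sigma_algebraType G) setT h G) => //.
  by move=> _ [B GB <-]; rewrite setTI; exact: hG.
have PD0 : 0 <= fine (P D) by rewrite fine_ge0.
have PDE : (fine (P D))%:E = P D by rewrite fineK// fin_num_measure.
pose Phi : {mfun T >-> g_sigma_algebraType G} :=
  HB.pack phi (isMeasurableFun.Build _ _ _ _ _ (meas phi mphi)).
pose Psi : {mfun T >-> g_sigma_algebraType G} :=
  HB.pack psi (isMeasurableFun.Build _ _ _ _ _ (meas psi mpsi)).
have E : forall B, pushforward (mscale (NngNum PD0) P) Psi B = (P D * P (psi @^-1` B))%E.
  by move=> B; rewrite /pushforward /mscale /= PDE.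
rewrite -E; have := @measure_unique _ R (g_sigma_algebraType G) G (fun=> setT) erefl GI
  (fun=> GT) _ (pushforward (mrestr P mC) Phi)
  (pushforward (mscale (NngNum PD0) P) Psi).
move=> /(_ _ (meas phi mphi) (meas psi mpsi)); apply => //.
- by apply/seteqP; split => // w _; exists 0%N.
- by move=> B GB; apply: etrans (esym (E B)); exact: GE.
- move=> k; apply: le_lt_trans (ltry 1).
  by apply: probability_le1; apply: measurableI => //; exact (mphi _ GT).
Qed.

End independence.

(** Measurability for the sigma-algebra generated by [rects N] encodes dependence on the first [N]
    steps only. *)
Definition rects {d} {V : measurableType d} (N : nat) : set (set (nat -> V)) :=
  [set A | exists2 B : nat -> set V, (forall i, measurable (B i)) &
     A = [set s | forall i, (i < N)%N -> B i (s i)]].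

Definition path_from {T V : Type} (Z : nat -> T -> V) k w : nat -> V :=
  fun i => Z (k + i)%N w.

Section iid_sequence.
Context {d d' : measure_display} {T : measurableType d} {V : measurableType d'}.
Context {R : realType} (P : probability T R) (Z : nat -> T -> V).
Hypothesis mZ : forall i, measurable_fun setT (Z i).
Hypothesis Zind : forall m (A : nat -> set V), (forall i, measurable (A i)) ->
  P [set w | forall i, (i < m)%N -> A i (Z i w)] =
  (\prod_(i < m) P (Z i @^-1` A i))%E.
Hypothesis Zst : forall i (A : set V), measurable A ->
  P (Z i @^-1` A) = P (Z 0%N @^-1` A).

Lemma rects_setI_closed N : setI_closed (@rects _ V N).
Proof.
move=> _ _ [B mB ->] [C mC ->]; exists (fun i => B i `&` C i).
  by move=> i; exact: measurableI.
apply/seteqP; split => [s [sB sC] i iN|s sBC].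
  by split; [exact: sB|exact: sC].
by split => i iN; have [] := sBC i iN.
Qed.

Lemma rects_setT N : @rects _ V N setT.
Proof. by exists (fun=> setT) => //; apply/seteqP; split. Qed.

Lemma measurable_rects_coord N i : (i < N)%N ->
  measurable_fun setT ((fun s => s i) : g_sigma_algebraType (@rects _ V N) -> V).
Proof.
move=> iN _ A mA; rewrite setTI; apply: sub_sigma_algebra.
exists (fun k => if k == i then A else setT).
  by move=> k; case: ifP.
apply/seteqP; split => [s /= sA k kN|s /(_ i iN)].
  by case: eqP => // ->.
by rewrite /= eqxx.
Qed.

Lemma measurable_path_from N k :
  measurable_fun setT (path_from Z k : T -> g_sigma_algebraType (@rects _ V N)).
Proof.
apply: (@measurability _ _ T (g_sigma_algebraType (rects N)) setT _ (rects N)) => //.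
move=> _ [_ [B mB ->] <-]; rewrite setTI.
have -> : path_from Z k @^-1` [set s | forall i, (i < N)%N -> B i (s i)] =
    \bigcap_(i in [set i | (i < N)%N]) (Z (k + i)%N @^-1` B i).
  by apply/seteqP; split.
apply: bigcap_measurableType => i _.
by rewrite -[X in measurable X]setTI; exact: mZ.
Qed.

(** Two rectangles concatenate into one over [k + N] steps; [pi_ext] then extends one side at a
    time. On the right both paths start at index 0, as a shift does not change the law. *)
Lemma path_indep k N (A B : set (nat -> V)) :
  <<s rects k >> A -> <<s rects N >> B ->
  P (path_from Z 0 @^-1` A `&` path_from Z k @^-1` B) =
  (P (path_from Z 0 @^-1` A) * P (path_from Z 0 @^-1` B))%E.
Proof.
have mp M j C : <<s rects M >> C -> measurable (path_from Z j @^-1` C).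
  by move=> sC; rewrite -[X in measurable X]setTI; exact: (@measurable_path_from M j measurableT).
have mpr M j C : rects M C -> measurable (path_from Z j @^-1` C).
  by move=> rC; apply: (mp M); exact: sub_sigma_algebra.
have rectE M C : (forall i, measurable (C i)) ->
    P (path_from Z 0 @^-1` [set s | forall i, (i < M)%N -> C i (s i)]) =
    (\prod_(i < M) P (Z 0%N @^-1` C i))%E.
  by move=> mC; rewrite (Zind M mC); apply: eq_bigr => i _; exact: Zst.
have rectI A' B' : rects k A' -> rects N B' ->
    P (path_from Z 0 @^-1` A' `&` path_from Z k @^-1` B') =
    (P (path_from Z 0 @^-1` A') * P (path_from Z 0 @^-1` B'))%E.
  move=> [F mF ->] [G mG ->]; rewrite !rectE//.
  pose H i := if (i < k)%N then F i else G (i - k)%N.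
  have mH i : measurable (H i) by rewrite /H; case: ifP.
  have Hk i : H (k + i)%N = G i by rewrite /H ltnNge leq_addr /= addKn.
  have -> : path_from Z 0 @^-1` [set s | forall i, (i < k)%N -> F i (s i)] `&`
      path_from Z k @^-1` [set s | forall i, (i < N)%N -> G i (s i)] =
      path_from Z 0 @^-1` [set s | forall i, (i < k + N)%N -> H i (s i)].
    apply/seteqP; split => [w [/= wF wG] i iN|w /= wH].
      rewrite /H; case: ltnP => ik; first exact: wF.
      have := wG (i - k)%N; rewrite /path_from subnKC// add0n; apply.
      by rewrite ltn_subLR.
    split => i iN /=.
      by have := wH i; rewrite /H iN; apply; rewrite ltn_addr.
    have := wH (k + i)%N; rewrite Hk ltn_add2l; exact.
  rewrite rectE// big_split_ord /=; congr (_ * _)%E; apply: eq_bigr => i _.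
    by rewrite /H ltn_ord.
  by rewrite Hk.
move=> sA sB.
have rB A' B' : rects k A' -> <<s rects N >> B' ->
    P (path_from Z k @^-1` B' `&` path_from Z 0 @^-1` A') =
    (P (path_from Z 0 @^-1` A') * P (path_from Z 0 @^-1` B'))%E.
  move=> rA; apply: pi_ext.
  - exact: rects_setI_closed.
  - exact: rects_setT.
  - exact: mpr.
  - exact: mpr.
  - exact: mpr rA.
  - exact: mpr rA.
  - by move=> C rC; rewrite setIC; exact: rectI.
rewrite muleC.
apply: (pi_ext (@rects_setI_closed k) (rects_setT k) (mpr k 0%N) (mpr k 0%N)
  (mp _ _ _ sB) (mp _ _ _ sB) _ sA) => C rC.
by rewrite muleC -rB// setIC.
Qed.

Lemma unit_rv_path N k (v : (nat -> V) -> R) :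
  measurable_fun setT (v : g_sigma_algebraType (rects N) -> R) ->
  (forall s, 0 <= v s <= 1) -> unit_rv (fun w => v (path_from Z k w)).
Proof.
move=> mv v01; split => [|w]; last exact: v01.
apply: (@measurableT_comp _ _ _ T (g_sigma_algebraType (rects N)) R v setT (path_from Z k)).
  exact: mv.
exact: measurable_path_from.
Qed.

Lemma EE_path_indep k N (u v : (nat -> V) -> R) :
  measurable_fun setT (u : g_sigma_algebraType (rects k) -> R) ->
  measurable_fun setT (v : g_sigma_algebraType (rects N) -> R) ->
  (forall s, 0 <= u s <= 1) -> (forall s, 0 <= v s <= 1) ->
  EE P (fun w => u (Z^~ w) * v (fun i => Z (k + i)%N w)) =
  EE P (fun w => u (Z^~ w)) * EE P (fun w => v (Z^~ w)).
Proof.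
move=> mu mv u01 v01.
apply: EE_mul_indep.
- exact: (unit_rv_path 0 mu).
- exact: (unit_rv_path k mv).
- exact: (unit_rv_path 0 mv).
move=> A B mA mB.
apply: (@path_indep k N (u @^-1` A) (v @^-1` B)).
  by have := mu measurableT _ mA; rewrite setTI.
by have := mv measurableT _ mB; rewrite setTI.
Qed.

End iid_sequence.

(** * Splitting a random walk at its first maximum *)

(* The truncation keeps every discrete functional in [0, 1] on the null set
   where the monotonicity of the subordinators fails. *)
Definition nexp {R : realType} (z : R) : R := expR (- Num.max 0 z).

Lemma nexp_itv {R : realType} (z : R) : 0 <= nexp z <= 1.
Proof. by rewrite expR_ge0 -expR0 ler_expR oppr_le0 le_max lexx. Qed.

Lemma nexpE {R : realType} (z : R) : 0 <= z -> nexp z = expR (- z).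
Proof. by move=> z0; rewrite /nexp max_r. Qed.

Lemma unit_itvM {R : realType} (x y : R) :
  0 <= x <= 1 -> 0 <= y <= 1 -> 0 <= x * y <= 1.
Proof. by move=> /andP[x0 x1] /andP[y0 y1]; rewrite mulr_ge0//= mulr_ile1. Qed.

Lemma bool_itv {R : realType} (b : bool) : 0 <= (b%:R : R) <= 1.
Proof. by case: b; rewrite ?lexx ?ler01. Qed.

Section measurable_functionals.
Context {d : measure_display} {S : measurableType d} {R : realType}.

Lemma measurable_nexp (f : S -> R) : measurable_fun setT f ->
  measurable_fun setT (fun s => nexp (f s)).
Proof.
move=> mf; apply: (measurableT_comp (f := expR)); first exact: measurable_expR.
apply: (@measurableT_comp _ _ _ S R R (@GRing.opp R) setT (fun s => Num.max 0 (f s))) => //.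
exact: measurable_maxr.
Qed.

Lemma measurable_bool_natr (b : S -> bool) : measurable_fun setT b ->
  measurable_fun setT (fun s => (b s)%:R : R).
Proof.
move=> mb; have -> : (fun s => (b s)%:R : R) = (fun s => if b s then 1 else 0).
  by apply/funext => s; case: (b s).
exact: measurable_fun_ifT.
Qed.

Lemma measurable_fun_forall (I : finType) (b : I -> S -> bool) :
  (forall i, measurable_fun setT (b i)) ->
  measurable_fun setT (fun s => [forall i, b i s]).
Proof.
move=> mb; apply: (measurable_fun_bool true); rewrite setTI.
have -> : (fun s => [forall i, b i s]) @^-1` [set true] =
    \bigcap_(i in [set: I]) (b i @^-1` [set true]).
  apply/seteqP; split => [s /= /forallP bs i _|s bs]; first exact: bs.
  by apply/forallP => i; exact: bs.
apply: fin_bigcap_measurable => // i _.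
by rewrite -[X in measurable X]setTI; exact: mb.
Qed.

Lemma measurable_finsum (I : finType) (f : I -> S -> R) :
  (forall i, measurable_fun setT (f i)) ->
  measurable_fun setT (fun s => \sum_i f i s).
Proof.
move=> mf; have -> : (fun s => \sum_i f i s) = (fun s => \sum_(i <- enum I) f i s).
  by apply/funext => s; rewrite big_enum.
exact: measurable_sum.
Qed.

Lemma measurable_condsum (I : finType) (A : pred I) (f : I -> S -> R) :
  (forall i, A i -> measurable_fun setT (f i)) ->
  measurable_fun setT (fun s => \sum_(i | A i) f i s).
Proof.
move=> mf; have -> : (fun s => \sum_(i | A i) f i s) =
    (fun s => \sum_i (if A i then f i s else 0)).
  by apply/funext => s; rewrite big_mkcond.
by apply: measurable_finsum => i; case: (boolP (A i)) => [/mf|].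
Qed.

Variables (w : S -> nat -> R) (M : nat).
Hypothesis mw : forall i, (i <= M)%N -> measurable_fun setT (fun s => w s i).

(** Value and index go through one induction, since each update is a case split on the value reached
    so far. *)
Lemma measurable_argmaxn N : (N <= M)%N ->
  measurable_fun setT (fun s => w s (argmaxn (w s) N)) /\
  measurable_fun setT (fun s => (argmaxn (w s) N)%:R : R).
Proof.
elim: N => [|N IH] NM /=; first by split => //; exact: mw.
have [m1 m2] := IH (ltnW NM).
have mlt : measurable_fun setT (fun s => w s (argmaxn (w s) N) < w s N.+1).
  by apply: measurable_fun_ltr => //; exact: mw.
split.
  have -> : (fun s => w s (if w s (argmaxn (w s) N) < w s N.+1 then N.+1 else argmaxn (w s) N)) =
      (fun s => if w s (argmaxn (w s) N) < w s N.+1 then w s N.+1 else w s (argmaxn (w s) N)).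
    by apply/funext => s; case: ifP.
  by apply: measurable_fun_ifT => //; exact: mw.
have -> : (fun s => (if w s (argmaxn (w s) N) < w s N.+1 then N.+1 else argmaxn (w s) N)%:R : R) =
    (fun s => if w s (argmaxn (w s) N) < w s N.+1 then N.+1%:R else (argmaxn (w s) N)%:R).
  by apply/funext => s; case: ifP.
exact: measurable_fun_ifT.
Qed.

Lemma measurable_strict_record k : (k <= M)%N ->
  measurable_fun setT (fun s => strict_record (w s) k).
Proof.
move=> kM; apply: measurable_fun_forall => i; apply: measurable_fun_ltr.
  by apply: mw; rewrite (leq_trans _ kM)// ltnW.
exact: mw.
Qed.

Lemma measurable_peak N k : (k + N <= M)%N ->
  measurable_fun setT (fun s => peak N (w s) k).
Proof.
move=> kM; apply: measurable_fun_forall => i; apply: measurable_fun_ler.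
  by apply: mw; rewrite (leq_trans _ kM)// leq_add2l -ltnS.
by apply: mw; rewrite (leq_trans _ kM)// leq_addr.
Qed.

End measurable_functionals.

Section walk.
Context {d : measure_display} {V : measurableType d} {R : realType} {L : finType}.
Variables (xi : L -> V -> R) (j : L).
Hypothesis mxi : forall l, measurable_fun setT (xi l).

Definition walk (s : nat -> V) (l : L) (k : nat) : R := \sum_(i < k) xi l (s i).

Lemma walk_shift s l k i :
  walk (fun i => s (k + i)%N) l i = walk s l (k + i) - walk s l k.
Proof. by rewrite /walk big_split_ord /= [X in _ = X - _]addrC addrK. Qed.

Definition pre_fun (a : R) (b : L -> R) k (s : nat -> V) : R :=
  (strict_record (walk s j) k)%:R * nexp (a * k%:R + \sum_l b l * walk s l k).

(** [peak] at 0 is the survival event: coordinate [j] does not rise above its starting value within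
    [N] steps. Each coordinate is then weighted at its own argmax. *)
Definition post_fun (a b : L -> R) N (s : nat -> V) : R :=
  (peak N (walk s j) 0)%:R *
  nexp (\sum_l (a l * (argmaxn (walk s l) N)%:R +
                b l * walk s l (argmaxn (walk s l) N))).

Lemma pre_fun_itv a b k s : 0 <= pre_fun a b k s <= 1.
Proof. exact: unit_itvM (bool_itv _) (nexp_itv _). Qed.

Lemma post_fun_itv a b N s : 0 <= post_fun a b N s <= 1.
Proof. exact: unit_itvM (bool_itv _) (nexp_itv _). Qed.

Lemma measurable_walk N l i : (i <= N)%N ->
  measurable_fun setT (fun s : g_sigma_algebraType (@rects _ V N) => walk s l i).
Proof.
move=> iN; rewrite /walk.
apply: measurable_finsum => k.
apply: (@measurableT_comp _ _ _ (g_sigma_algebraType (@rects _ V N)) V R (xi l) setT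
  (fun s => s k)); first exact: mxi.
by apply: measurable_rects_coord; rewrite (leq_trans _ iN).
Qed.

Lemma measurable_pre_fun a b k :
  measurable_fun setT (pre_fun a b k : g_sigma_algebraType (@rects _ V k) -> R).
Proof.
apply: measurable_funM.
  apply: measurable_bool_natr; apply: (@measurable_strict_record _ _ _ _ k) => //.
  by move=> i ik; exact: measurable_walk.
apply: measurable_nexp; apply: measurable_funD => //.
apply: measurable_finsum => l; apply: measurable_funM => //; exact: measurable_walk.
Qed.

Lemma measurable_post_fun a b N :
  measurable_fun setT (post_fun a b N : g_sigma_algebraType (@rects _ V N) -> R).
Proof.
have mW l i : (i <= N)%N -> measurable_fun setT
    (fun s : g_sigma_algebraType (@rects _ V N) => walk s l i).
  exact: measurable_walk.
apply: measurable_funM.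
  apply: measurable_bool_natr; apply: (@measurable_peak _ _ _ _ N) => //.
  exact: mW.
apply: measurable_nexp.
apply: measurable_finsum => l.
have [m1 m2] := measurable_argmaxn (mW l) (leqnn N).
by apply: measurable_funD; apply: measurable_funM.
Qed.

(* At most one k < N is a strict record over the past and a maximum over the
   next N steps; it is the first maximum once N is large. *)
Definition split_fun (a : R) (b a' b' : L -> R) N (s : nat -> V) : R :=
  \sum_(k < N) pre_fun a b k s * post_fun a' b' N (fun i => s (k + i)%N).

Definition split_term (a : R) (b a' b' : L -> R) N (s : nat -> V) (k : nat) : R :=
  nexp (a * k%:R + \sum_l b l * walk s l k) *
  nexp (\sum_l (a' l * (argmaxn (fun i => walk s l (k + i)%N - walk s l k) N)%:R +
    b' l * (walk s l (k + argmaxn (fun i => (walk s l (k + i)%N - walk s l k)%R) N) -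
            walk s l k))).

Lemma split_term_itv a b a' b' N s k : 0 <= split_term a b a' b' N s k <= 1.
Proof. exact: unit_itvM (nexp_itv _) (nexp_itv _). Qed.

(** The walk of the shifted steps is the increment after [k], so survival of the shifted walk is
    [peak] at [k]. *)
Lemma pre_post_summit a b a' b' N s k :
  pre_fun a b k s * post_fun a' b' N (fun i => s (k + i)%N) =
  (summit N (walk s j) k)%:R * split_term a b a' b' N s k.
Proof.
rewrite /pre_fun /post_fun /summit /split_term.
have wE l : walk (fun i => s (k + i)%N) l = (fun i => walk s l (k + i) - walk s l k).
  by apply/funext => i; exact: walk_shift.
have -> : peak N (walk (fun i => s (k + i)%N) j) 0 = peak N (walk s j) k.
  by apply: eq_forallb => i; rewrite !walk_shift add0n addn0 subrr subr_le0.
rewrite -mulnb natrM mulrACA; congr (_ * (_ * nexp _)).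
by apply: eq_bigr => l _; rewrite wE.
Qed.

Lemma split_funE a b a' b' N s :
  split_fun a b a' b' N s =
  \sum_(k < N) (summit N (walk s j) k)%:R * split_term a b a' b' N s k.
Proof. by apply: eq_bigr => k _; exact: pre_post_summit. Qed.

Lemma split_fun_itv a b a' b' N s : 0 <= split_fun a b a' b' N s <= 1.
Proof.
rewrite split_funE; apply: (@sum_summit_itv _ N (walk s j) (split_term a b a' b' N s)) => k.
exact: split_term_itv.
Qed.

End walk.

Section walk_expectation.
Context {d d' : measure_display} {T : measurableType d} {V : measurableType d'}.
Context {R : realType} (P : probability T R) (Z : nat -> T -> V).
Hypothesis mZ : forall i, measurable_fun setT (Z i).
Hypothesis Zind : forall m (A : nat -> set V), (forall i, measurable (A i)) ->
  P [set w | forall i, (i < m)%N -> A i (Z i w)] =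
  (\prod_(i < m) P (Z i @^-1` A i))%E.
Hypothesis Zst : forall i (A : set V), measurable A ->
  P (Z i @^-1` A) = P (Z 0%N @^-1` A).
Variables (L : finType) (xi : L -> V -> R) (j : L).
Hypothesis mxi : forall l, measurable_fun setT (xi l).

Lemma unit_rv_split_term a b a' b' N k : unit_rv (fun w =>
  pre_fun xi j a b k (Z^~ w) * post_fun xi j a' b' N (fun i => Z (k + i)%N w)).
Proof.
apply: unit_rvM.
  exact: (unit_rv_path mZ 0 (@measurable_pre_fun _ _ _ _ xi j mxi a b k) (pre_fun_itv xi j a b k)).
exact: (unit_rv_path mZ k (@measurable_post_fun _ _ _ _ xi j mxi a' b' N)
  (post_fun_itv xi j a' b' N)).
Qed.

Lemma unit_rv_split a b a' b' N :
  unit_rv (fun w => split_fun xi j a b a' b' N (Z^~ w)).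
Proof.
split => [|w]; last exact: split_fun_itv.
by apply: measurable_finsum => k; have [] := unit_rv_split_term a b a' b' N k.
Qed.

(** The shifted steps have the law of the original ones, so the factor after the cut is the same for
    all [k]. *)
Lemma EE_split a b a' b' N :
  EE P (fun w => split_fun xi j a b a' b' N (Z^~ w)) =
  (\sum_(k < N) EE P (fun w => pre_fun xi j a b k (Z^~ w))) *
  EE P (fun w => post_fun xi j a' b' N (Z^~ w)).
Proof.
rewrite /split_fun EE_sum; last by move=> k; exact: unit_rv_split_term.
rewrite mulr_suml; apply: eq_bigr => k _.
apply: (EE_path_indep mZ Zind Zst (@measurable_pre_fun _ _ _ _ xi j mxi a b k)
  (@measurable_post_fun _ _ _ _ xi j mxi a' b' N)) => s.
  exact: pre_fun_itv.
exact: post_fun_itv.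
Qed.

(** By [EE_split] each mean is a function of the parameters before the cut times a function of those
    after it. *)
Lemma EE_split_exchange a1 b1 a2 b2 a b a' b' N :
  EE P (fun w => split_fun xi j a1 b1 a b N (Z^~ w)) *
  EE P (fun w => split_fun xi j a2 b2 a' b' N (Z^~ w)) =
  EE P (fun w => split_fun xi j a1 b1 a' b' N (Z^~ w)) *
  EE P (fun w => split_fun xi j a2 b2 a b N (Z^~ w)).
Proof. by rewrite !EE_split mulrACA [X in _ * X]mulrC -mulrACA. Qed.

End walk_expectation.

(** * Increments of Levy processes *)

Lemma borel_preimage {R : realType} (V : normedModType R) (f : V -> R) (A : set R) :
  continuous f -> measurable A -> borel (f @^-1` A).
Proof.
move=> cf mA.
have mf : measurable_fun setT (f : g_sigma_algebraType (@open V) -> R).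
  apply: (@measurability _ _ (g_sigma_algebraType (@open V)) R setT f _
    (RGenOpens.measurableE R)).
  move=> _ [_ [a [b ->] <-]]; rewrite setTI; apply: sub_sigma_algebra.
  by move/continuousP : cf; apply; exact: interval_open.
by have := mf measurableT _ mA; rewrite setTI.
Qed.

Lemma measurable_borel {R : realType} (A : set R) :
  measurable A -> @borel R^o A.
Proof. by move=> mA; apply: (@borel_preimage R R^o id) => // z; exact: cvg_id. Qed.

(* Used instead of the Borel sets, for which the measurability of the vector
   difference X_t - X_s is not at hand. *)
Definition coordinate_sets {R : realType} {n : nat} : set (set 'rV[R]_n.+1) :=
  \bigcup_(l in [set: 'I_n.+1])
    preimage_set_system setT (fun v : 'rV[R]_n.+1 => v 0 l) measurable.

Lemma measurable_coordinate {R : realType} {n : nat} (l : 'I_n.+1) :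
  measurable_fun setT
    (fun v : g_sigma_algebraType (@coordinate_sets R n) => (v : 'rV[R]_n.+1) 0 l).
Proof.
move=> _ A mA; apply: sub_sigma_algebra; exists l => //.
by exists A.
Qed.

Lemma coordinate_sets_borel {R : realType} {n : nat} (A : set 'rV[R]_n.+1) :
  <<s coordinate_sets >> A -> borel A.
Proof.
apply: smallest_sub; first exact: smallest_sigma_algebra.
move=> _ [l _ [B mB <-]]; rewrite setTI.
apply: (@borel_preimage R 'rV[R]_n.+1 (fun v => v 0 l)) => //.
exact: coord_continuous.
Qed.

Section levy_increments.
Context {d : measure_display} {T : measurableType d} {R : realType}.
Context {P : probability T R}.

Lemma levy_measurable_coord {n : nat} (X : R -> T -> 'rV[R]_n.+1) t l :
  levy_process P X -> 0 <= t -> measurable_fun setT (fun w => X t w 0 l).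
Proof.
move=> lX t0 _ A mA; apply: (levy_measurable lX t0).
exists ((fun v : 'rV[R]_n.+1 => v 0 l) @^-1` A); last by rewrite setTI.
apply: borel_preimage => //; exact: coord_continuous.
Qed.

Lemma levy_measurable_real (Y : R -> T -> R) t :
  levy_process P (Y : R -> T -> R^o) -> 0 <= t -> measurable_fun setT (Y t).
Proof.
move=> lY t0 _ A mA; apply: (levy_measurable lY t0).
by exists A => //; exact: measurable_borel.
Qed.

Lemma levy_increments_indep (V : normedModType R) (X : R -> T -> V) (t : nat -> R)
    m (A : nat -> set V) :
  levy_process P X -> 0 <= t 0%N -> (forall i, t i <= t i.+1) ->
  (forall i, borel (A i)) ->
  P [set w | forall i, (i < m)%N -> A i (X (t i.+1) w - X (t i) w)] =
  (\prod_(i < m) P [set w | A i (X (t i.+1) w - X (t i) w)%R])%E.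
Proof.
move=> lX t0 tm bA.
have := @levy_independent _ _ _ _ _ _ lX m t t0 tm [set: 'I_m]%SET
  (fun i : 'I_m => [set w | A i (X (t i.+1) w - X (t i) w)]).
move=> h.
have -> : [set w | forall i, (i < m)%N -> A i (X (t i.+1) w - X (t i) w)] =
    \bigcap_(i in [set` [set: 'I_m]%SET]) [set w | A i (X (t i.+1) w - X (t i) w)].
  apply/seteqP; split => [w wA i _|w wA i im]; first exact: wA.
  by apply: (wA (Ordinal im)); rewrite /= inE.
rewrite h.
  by apply: eq_bigl => i; rewrite inE.
move=> i _; exists (A i); first exact: bA.
by rewrite setTI.
Qed.

Section grid.
Context {n : nat} (X : R -> T -> 'rV[R]_n.+1) (h : R).
Hypotheses (lX : levy_process P X) (h0 : 0 <= h).

Definition increment (i : nat) (w : T) : 'rV[R]_n.+1 :=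
  X (i.+1%:R * h) w - X (i%:R * h) w.

Lemma measurable_increment i : measurable_fun setT
  (increment i : T -> g_sigma_algebraType (@coordinate_sets R n)).
Proof.
apply: (@measurability _ _ T (g_sigma_algebraType coordinate_sets) setT _
  coordinate_sets) => //.
move=> _ [_ [l _ [B mB <-]] <-]; rewrite !setTI.
have : measurable_fun setT (fun w => X (i.+1%:R * h) w 0 l - X (i%:R * h) w 0 l).
  by apply: measurable_funB; apply: levy_measurable_coord => //; rewrite mulr_ge0.
move=> /(_ measurableT B mB); rewrite setTI.
rewrite (_ : _ @^-1` B = increment i @^-1` ((fun v : 'rV[R]_n.+1 => v 0 l) @^-1` B)) //.
by apply/seteqP; split => w /=; rewrite /increment !mxE.
Qed.

Lemma increment_indep m
    (A : nat -> set (g_sigma_algebraType (@coordinate_sets R n))) :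
  (forall i, measurable (A i)) ->
  P [set w | forall i, (i < m)%N -> A i (increment i w)] =
  (\prod_(i < m) P (increment i @^-1` A i))%E.
Proof.
move=> mA; apply: (@levy_increments_indep _ X (fun i => i%:R * h)) => //.
- by rewrite mul0r.
- by move=> i; rewrite ler_wpM2r// ler_nat.
- by move=> i; apply: coordinate_sets_borel; exact: mA.
Qed.

Lemma increment_stationary i
    (A : set (g_sigma_algebraType (@coordinate_sets R n))) :
  measurable A -> P (increment i @^-1` A) = P (increment 0%N @^-1` A).
Proof.
move=> mA; have bA : borel (A : set 'rV[R]_n.+1) by exact: coordinate_sets_borel.
suff H k : P (increment k @^-1` A) = P [set w | A (X h w)] by rewrite !H.
have k0 : 0 <= k%:R * h by rewrite mulr_ge0.
have kk : k%:R * h <= k.+1%:R * h by rewrite ler_wpM2r// ler_nat.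
have := levy_stationary lX k0 kk bA.
by rewrite -mulrBl -natrB// subSn// subnn mul1r.
Qed.

End grid.

(** * Laplace exponent of a subordinator at dyadic times *)

Section subordinator_exponent.
Context (Y : R -> T -> R) (b : R).
Hypotheses (sY : subordinator P Y) (b0 : 0 <= b).

Let lY : levy_process P (Y : R -> T -> R^o) := sY.1.
Let phi t := EE P (fun w => expR (- (b * Y t w))).

Lemma subordinator_ge0 : {ae P, forall w, forall t, 0 <= t -> 0 <= Y t w}.
Proof.
apply: filterS2 (levy_start lY) sY.2 => w Y0 Ym t t0.
by rewrite -Y0; apply: Ym.
Qed.

Lemma unit_rv_nexp (f : T -> R) : measurable_fun setT f ->
  unit_rv (fun w => nexp (f w)).
Proof. by move=> mf; split => [|w]; [exact: measurable_nexp|exact: nexp_itv]. Qed.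

Lemma measurable_subordinator t : 0 <= t -> measurable_fun setT (Y t).
Proof. exact: levy_measurable_real. Qed.

Lemma unit_rv_laplace t : 0 <= t -> unit_rv (fun w => nexp (b * Y t w)).
Proof.
by move=> t0; apply: unit_rv_nexp; apply: measurable_funM => //; exact: measurable_subordinator.
Qed.

Lemma laplace_nexp t : 0 <= t -> phi t = EE P (fun w => nexp (b * Y t w)).
Proof.
move=> t0; apply: EE_ae => [w|w|]; rewrite ?expR_ge0//.
apply: filterS subordinator_ge0 => w Y0.
by rewrite nexpE// mulr_ge0// Y0.
Qed.

(** Independent stationary increments over [0, s] and [s, s + t]. [Y s] is replaced by [Y s - Y 0]
    because [Y] starts at 0 only almost surely. *)
Lemma laplace_mul s t : 0 <= s -> 0 <= t -> phi (s + t) = phi s * phi t.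
Proof.
move=> s0 t0; have st0 : 0 <= s + t by rewrite addr_ge0.
have sst : s <= s + t by rewrite lerDl.
have mY := measurable_subordinator.
pose U w := nexp (b * (Y s w - Y 0 w)).
pose V w := nexp (b * (Y (s + t) w - Y s w)).
have uU : unit_rv U.
  by apply: unit_rv_nexp; apply: measurable_funM => //; apply: measurable_funB; exact: mY.
have uV : unit_rv V.
  by apply: unit_rv_nexp; apply: measurable_funM => //; apply: measurable_funB; exact: mY.
have mnexp : measurable_fun setT (fun y : R => nexp (b * y)).
  by apply: measurable_nexp; exact: measurable_funM.
have pre (B : set R) : measurable B -> borel ((fun y : R^o => nexp (b * y)) @^-1` B).
  move=> mB; apply: measurable_borel.
  by have := mnexp measurableT _ mB; rewrite setTI.
rewrite (laplace_nexp s0) (laplace_nexp t0).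
have -> : EE P (fun w => nexp (b * Y s w)) = EE P U.
  apply: EE_ae => [w|w|]; rewrite ?expR_ge0//.
  by apply: filterS (levy_start lY) => w Y0; rewrite /U Y0 subr0.
rewrite -(EE_mul_indep uU uV (unit_rv_laplace t0)); last first.
  move=> A B mA mB.
  (* Times 0, s, s + t, constant afterwards; only the first two increments are used. *)
  pose tt i : R := if i is i'.+1 then (if i' is _.+1 then s + t else s) else 0.
  have ttm i : tt i <= tt i.+1 by case: i => [|[|i]].
  pose C i : set R^o := (fun y : R^o => nexp (b * y)) @^-1` (if i == 0%N then A else B).
  have bC i : borel (C i) by rewrite /C; case: ifP => _; exact: pre.
  have := @levy_increments_indep _ _ tt 2 C lY (lexx 0) ttm bC.
  rewrite big_ord_recl big_ord1 /=.
  have -> : [set w | forall i, (i < 2)%N -> C i (Y (tt i.+1) w - Y (tt i) w)] =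
      U @^-1` A `&` V @^-1` B.
    apply/seteqP; split => [w h|w [h1 h2] [|[|]]//].
    by split; [exact: (h 0%N)|exact: (h 1%N)].
  move=> ->; congr (_ * _)%E.
  have := levy_stationary lY s0 sst (pre B mB).
  by rewrite addrAC subrr add0r.
apply: EE_ae => [w|w|].
- exact: expR_ge0.
- by rewrite mulr_ge0// expR_ge0.
apply: filterS2 (levy_start lY) sY.2 => w Y0 Ym.
rewrite /U /V !nexpE ?mulr_ge0// ?subr_ge0 ?Ym//.
by rewrite -expRD -opprD -mulrDr; congr (expR (- (_ * _))); rewrite Y0; ring.
Qed.

Lemma laplace_gt0 t : 0 <= t -> 0 < phi t.
Proof.
move=> t0; apply: (EE_gt0 (unit_rv_laplace t0)) => [w|]; first exact: expR_gt0.
apply: filterS subordinator_ge0 => w Y0.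
by rewrite nexpE// mulr_ge0// Y0.
Qed.

Lemma theta_ge0 : 0 <= theta P Y b.
Proof.
rewrite /theta oppr_ge0 ln_le0// -/(phi 1) laplace_nexp//.
by case/andP: (EE_itv P (unit_rv_laplace ler01)).
Qed.

(** The power 2^q of phi(2^-q) is phi(1), which is exp(-theta), and nonnegative roots are unique; no
    continuity in time is involved. *)
Lemma laplace_dyadic q i :
  phi (i%:R / 2 ^+ q) = expR (- (theta P Y b * (i%:R / 2 ^+ q))).
Proof.
set h := 2 ^- q; have h0 : 0 <= h by rewrite invr_ge0 exprn_ge0.
have powE k : phi (k%:R * h) = phi h ^+ k.
  elim: k => [|k IH].
    rewrite mul0r expr0 laplace_nexp// (EE_ae (g := cst 1)).
    - by rewrite /EE expectation_cst.
    - by move=> w; rewrite expR_ge0.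
    - by move=> w /=.
    - by apply: filterS (levy_start lY) => w ->; rewrite mulr0 nexpE// oppr0 expR0.
  by rewrite -natr1 mulrDl mul1r laplace_mul ?mulr_ge0// IH exprSr.
have q0 : 0 < 2 ^+ q :> R by rewrite exprn_gt0.
have phih : phi h = expR (- (theta P Y b * h)).
  have : phi h ^+ (2 ^ q) = expR (- (theta P Y b * h)) ^+ (2 ^ q).
    rewrite -powE natrX divff ?gt_eqF// -expRM_natr.
    rewrite natrX mulNr -mulrA mulVf ?gt_eqF// mulr1 /theta opprK lnK//.
    by rewrite posrE laplace_gt0.
  move=> /eqP; rewrite eqrXn2 ?expn_gt0 ?expR_ge0 ?(ltW (laplace_gt0 h0))//.
  by move=> /eqP.
by rewrite powE phih -expRM_natl; congr expR; ring.
Qed.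

End subordinator_exponent.

End levy_increments.

Section mutual_independence.
Context {d : measure_display} {T : measurableType d} {R : realType}.
Context {P : probability T R} {I : finType} (F : I -> set (set T)).
Hypotheses (Fm : forall i, F i `<=` measurable) (FI : forall i, setI_closed (F i))
  (FT : forall i, F i setT) (Find : mutually_independent P F).

Definition joint_sets (J : {set I}) : set (set T) := \bigcup_(i in [set` J]) F i.

(** A pi-system on which mutual independence applies directly; its sigma-algebra contains the one
    generated by [joint_sets J]. *)
Let boxes (J : {set I}) : set (set T) :=
  [set A | exists2 B : I -> set T, (forall i, F i (B i)) &
     A = \bigcap_(i in [set` J]) B i].

Let boxes_setI_closed J : setI_closed (boxes J).
Proof.
move=> _ _ [B FB ->] [C FC ->]; exists (fun i => B i `&` C i).
  by move=> i; exact: FI.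
apply/seteqP; split => [w [wB wC] i iJ|w wBC]; first by split; [exact: wB|exact: wC].
by split => i iJ; have [] := wBC i iJ.
Qed.

Let boxes_setT J : boxes J setT.
Proof. by exists (fun=> setT) => //; rewrite bigcapT. Qed.

Let boxes_measurable J A : boxes J A -> measurable A.
Proof. by move=> [B FB ->]; apply: fin_bigcap_measurable => // i _; exact/Fm/FB. Qed.

Let sub_boxes J : <<s joint_sets J >> `<=` <<s boxes J >>.
Proof.
apply: smallest_sub; first exact: smallest_sigma_algebra.
move=> A [i iJ FA]; apply: sub_sigma_algebra.
exists (fun k => if k == i then A else setT).
  by move=> k; case: eqP => [->|_]; [|exact: FT].
apply/seteqP; split => [w wA k _|w /(_ i iJ)]; last by rewrite eqxx.
by case: ifP.
Qed.

Lemma joint_sets_measurable J : <<s joint_sets J >> `<=` measurable.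
Proof.
apply: smallest_sub; first exact: sigma_algebra_measurable.
by move=> A [i _ FA]; exact: Fm FA.
Qed.

Lemma joint_sets_indep (J : {set I}) i A B : i \notin J -> <<s joint_sets J >> A -> F i B ->
  P (A `&` B) = (P A * P B)%E.
Proof.
move=> iJ /sub_boxes sA FB; have mB := Fm FB.
rewrite muleC.
apply: (@pi_ext _ _ _ P _ (boxes J) id id B B) sA => //.
- exact: boxes_measurable.
- exact: boxes_measurable.
move=> _ [C FC ->].
pose D k := if k == i then B else C k.
have FD k : F k (D k) by rewrite /D; case: eqP => [->|_].
have DC k : k \in J -> D k = C k.
  by move=> kJ; rewrite /D; case: eqP => // ki; rewrite -ki kJ in iJ.
have E1 : \bigcap_(k in [set` J]) C k = \bigcap_(k in [set` J]) D k.
  by apply: eq_bigcapr => k kJ; rewrite DC.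
have -> : id @^-1` (\bigcap_(k in [set` J]) C k) `&` B =
    \bigcap_(k in [set` (i |: J)%SET]) D k.
  rewrite preimage_id E1; apply/seteqP; split => [w [wD wB] k|w wD].
    by rewrite /= in_setU1 => /orP[/eqP ->|/wD//]; rewrite /D eqxx.
  split; first by move=> k kJ; apply: wD; rewrite /= in_setU1; apply/orP; right.
  by have := wD i; rewrite /D eqxx; apply; rewrite /= in_setU1 eqxx.
rewrite preimage_id E1 (Find (J := (i |: J)%SET)); last by move=> k _; exact: FD.
rewrite (Find (J := J)); last by move=> k _; exact: FD.
by rewrite big_setU1//= {1}/D eqxx.
Qed.

(** Induction on [s]: [V i] is absorbed into [U] and [i] into [J], so each step needs only the
    independence of one member from a group. *)
Lemma EE_indep_prod (s : seq I) (J : {set I}) (U : T -> R) (V : I -> T -> R) :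
  uniq s -> (forall i, i \in s -> i \notin J) ->
  measurable_fun setT (U : g_sigma_algebraType (joint_sets J) -> R) ->
  (forall w, 0 <= U w <= 1) ->
  (forall i (B : set R), i \in s -> measurable B -> F i (V i @^-1` B)) ->
  (forall i w, 0 <= V i w <= 1) ->
  EE P (fun w => U w * \prod_(i <- s) V i w) = EE P U * \prod_(i <- s) EE P (V i).
Proof.
have unitJ J' (U' : T -> R) : measurable_fun setT (U' : g_sigma_algebraType (joint_sets J') -> R) ->
    (forall w, 0 <= U' w <= 1) -> @unit_rv _ T R U'.
  move=> mU U01; split => // _ A mA; rewrite setTI.
  by apply: (@joint_sets_measurable J'); have := mU measurableT _ mA; rewrite setTI.
elim: s J U => [|i s IH] J U /=.
  by move=> _ _ mU U01 _ _; rewrite big_nil mulr1; congr EE; apply/funext => w;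
    rewrite big_nil mulr1.
move=> /andP[is_ us] sJ mU U01 FV V01.
have iJ : i \notin J by apply: sJ; rewrite in_cons eqxx.
have FVi (B : set R) : measurable B -> F i (V i @^-1` B).
  by move=> mB; apply: FV => //; rewrite in_cons eqxx.
have uV : unit_rv (V i).
  by split => // _ B mB; rewrite setTI; apply/Fm/FVi.
have -> : EE P (fun w => U w * \prod_(k <- i :: s) V k w) =
    EE P (fun w => (U w * V i w) * \prod_(k <- s) V k w).
  by congr EE; apply/funext => w; rewrite big_cons mulrA.
rewrite (IH (i |: J)%SET) => //.
- rewrite (@EE_mul_indep _ _ _ _ U (V i) (V i)) //.
  + by rewrite big_cons mulrA.
  + exact: unitJ mU U01.
  move=> A B mA mB; apply: (@joint_sets_indep J i) => //.
    by have := mU measurableT _ mA; rewrite setTI.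
  exact: FVi.
- move=> k ks; rewrite in_setU1 negb_or; apply/andP; split.
    by apply/eqP => ki; rewrite -ki ks in is_.
  by apply: sJ; rewrite in_cons ks orbT.
- apply: measurable_funM.
    move=> _ A mA; rewrite setTI.
    have := mU measurableT _ mA; rewrite setTI.
    apply: smallest_sub; first exact: smallest_sigma_algebra.
    move=> B [k kJ FB]; apply: sub_sigma_algebra; exists k => //.
    by rewrite /= in_setU1; apply/orP; right.
  move=> _ A mA; rewrite setTI; apply: sub_sigma_algebra.
  by exists i; [rewrite /= in_setU1 eqxx|exact: FVi].
- by move=> w; exact: unit_itvM.
- by move=> k B ks; apply: FV; rewrite in_cons ks orbT.
Qed.

End mutual_independence.

(** * Paths of the network *)

Lemma iter_near_forall (I : finType) (A : I -> nat -> nat -> Prop) :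
  (forall i, iter_near (A i)) -> iter_near (fun m q => forall i, A i m q).
Proof.
move=> hA.
have := @filter_forall nat I (fun i => [set m | \forall q \near \oo, A i m q]) \oo _ hA.
move=> /(_ _) h; apply: (filterS _ h) => m hm.
exact: (@filter_forall nat I (fun i => A i m) \oo _ hm).
Qed.

Section Kprod.
Context {R : realType} {n : nat} (K : 'I_n.+1 -> R).
Hypothesis K0 : forall k : 'I_n.+1, (0 < k)%N -> 0 < K k.

Lemma Kprod_diag j : Kprod K j j = 1.
Proof. by apply: big_pred0 => i; case: ltngtP. Qed.

Lemma Kprod_gt0 j l : 0 < Kprod K j l.
Proof.
apply: prodr_gt0 => i /andP[ji _]; apply: K0; exact: leq_ltn_trans ji.
Qed.

Lemma Kprod_mul (j i l : 'I_n.+1) : (j <= i <= l)%N ->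
  Kprod K j l = Kprod K j i * Kprod K i l.
Proof.
move=> /andP[ji il]; rewrite /Kprod (bigID (fun k : 'I_n.+1 => (k <= i)%N)) /=.
congr (_ * _); apply: eq_bigl => k.
  by case: (leqP k i) => ki; rewrite ?andbF ?andbT// (leq_trans ki il) andbT.
by case: (leqP k i) => ki; rewrite ?andbF ?andbT// (leq_ltn_trans ji ki).
Qed.

Lemma Kprod_succ (i l : 'I_n.+1) : l = i.+1 :> nat -> Kprod K i l = K l.
Proof.
move=> li; rewrite /Kprod (big_pred1 l)// => k /=.
by rewrite -(inj_eq val_inj) /= eq_sym eqn_leq li.
Qed.

End Kprod.

Section network_path.
Context {R : realType} {n : nat} (x U : 'I_n.+1 -> R -> R) (K : 'I_n.+1 -> R).
Hypothesis K0 : forall k : 'I_n.+1, (0 < k)%N -> 0 < K k.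
Hypothesis xc : forall k, cadlag (x k : R -> R^o).
Hypothesis xoo : forall k, x k t @[t --> +oo] --> -oo.
Hypothesis x0 : forall k, x k 0 = 0.
Hypothesis xU : forall j k : 'I_n.+1, k = j.+1 :> nat ->
  forall t : R, 0 <= t -> x k t = K k * x j t + U k t.
Hypothesis Um : forall k : 'I_n.+1, (0 < k)%N ->
  forall s t : R, 0 <= s -> s <= t -> U k s <= U k t.

Lemma network_decomp (j l : 'I_n.+1) t : (j <= l)%N -> 0 <= t ->
  x l t = Kprod K j l * x j t + \sum_(i < n.+1 | (j < i <= l)%N) Kprod K i l * U i t.
Proof.
move=> jl t0; move: jl; have [p] := ubnP l; elim: p l => // p IH l lp.
rewrite leq_eqVlt => /orP[/eqP jl|jl].
  have -> : l = j by exact: val_inj.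
  rewrite Kprod_diag mul1r big_pred0 ?addr0// => i.
  by case: ltngtP.
have l0 : (0 < l)%N by exact: leq_ltn_trans jl.
have l1n : (l.-1 < n.+1)%N by rewrite (leq_ltn_trans (leq_pred _)).
pose i' := Ordinal l1n; have li' : l = i'.+1 :> nat by rewrite /= prednK.
have ji' : (j <= i')%N by rewrite -ltnS -li'.
rewrite (xU li' t0) IH//; last by rewrite -ltnS -li'.
have KE (k : 'I_n.+1) : (k <= i')%N -> Kprod K k l = Kprod K k i' * K l.
  by move=> ki; rewrite (@Kprod_mul _ _ K k i' l) ?(Kprod_succ K li')// ki li' leqnSn.
rewrite (KE j)// [in RHS](bigD1 l) /=; last by rewrite jl leqnn.
rewrite Kprod_diag mul1r mulrDr mulrA [K l * _]mulrC -addrA; congr (_ + _).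
rewrite addrC; congr (_ + _); rewrite mulr_sumr; apply: eq_big => i.
  rewrite -(inj_eq val_inj) /= -andbA; congr (_ && _).
  by rewrite andbC -ltn_neqAle li'.
by move=> /andP[ji ii']; rewrite KE// mulrA [K l * _]mulrC.
Qed.

Definition tilt m l t : R := x l t - Kprod K ord0 l / m.+1%:R * t.

(** Since K_1^l = K_1^j K_j^l, the drifts match and the same nondecreasing [U] remain as for the
    untilted paths. *)
Lemma tilt_decomp m (j l : 'I_n.+1) t : (j <= l)%N -> 0 <= t ->
  tilt m l t = Kprod K j l * tilt m j t +
    \sum_(i < n.+1 | (j < i <= l)%N) Kprod K i l * U i t.
Proof.
move=> jl t0; rewrite /tilt (network_decomp jl t0).
rewrite (@Kprod_mul _ _ K ord0 j l)//; ring.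
Qed.

Lemma tilt0 m l : tilt m l 0 = 0.
Proof. by rewrite /tilt x0 mulr0 subrr. Qed.

(** Positive constants and nondecreasing [U] carry an upward move of coordinate [j] over to
    coordinate [l]; hence before the argmax of [j], coordinate [l] never exceeds its value there. *)
Lemma tilt_mono m (j l : 'I_n.+1) s t : (j <= l)%N -> 0 <= s -> s <= t ->
  tilt m j s <= tilt m j t -> tilt m l s <= tilt m l t.
Proof.
move=> jl s0 st h; have t0 := le_trans s0 st.
rewrite !(tilt_decomp m jl)// lerD// ?ler_pM2l ?Kprod_gt0//.
apply: ler_sum => i /andP[ji _]; rewrite ler_pM2l ?Kprod_gt0//.
by apply: Um => //; exact: leq_ltn_trans ji.
Qed.

Lemma tilt_le m l t : 0 <= t -> tilt m l t <= x l t.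
Proof.
by move=> t0; rewrite /tilt lerBlDr lerDl mulr_ge0// divr_ge0// ltW// Kprod_gt0.
Qed.

Lemma network_negative : exists H : nat, (0 < H)%N /\
  forall l t, H%:R <= t -> x l t < 0.
Proof.
have /filter_forall[M [_ hM]] : forall l, \forall t \near +oo, x l t < 0.
  by move=> l; have /cvgrNyPlt/(_ 0) := xoo l.
pose H := (Num.truncn (Num.max 0 M)).+1.
exists H; split => // l t Ht; apply: hM; apply: lt_le_trans Ht.
have /truncn_itv/andP[_ h] : 0 <= Num.max 0 M by rewrite le_max lexx.
by rewrite (le_lt_trans _ h)// le_max lexx orbT.
Qed.

Variables (j : 'I_n.+1) (A : R) (b a' b' : 'I_n.+1 -> R).
Hypotheses (A0 : 0 <= A) (b0 : forall l, 0 <= b l)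
  (a'0 : forall l, 0 <= a' l) (b'0 : forall l, 0 <= b' l).
Hypothesis b_below : forall l : 'I_n.+1, (l < j)%N -> b l = 0.
Hypothesis b_above : forall l : 'I_n.+1, (j < l)%N -> b l = b' l.
Hypothesis ab_below : forall l : 'I_n.+1, (l <= j)%N -> a' l = 0 /\ b' l = 0.

(* Coordinates above j are weighted by f at the peak of coordinate j and by the
   remaining increment g - f afterwards. *)
Lemma big_split_above (f g : 'I_n.+1 -> R) :
  \sum_l b l * f l + \sum_l b' l * (g l - f l) = b j * f j + \sum_l b' l * g l.
Proof.
rewrite -big_split /= (bigD1 j) //= [in RHS](bigD1 j) //=.
have [_ ->] := ab_below (leqnn j); rewrite !mul0r !(addr0, add0r); congr (_ + _).
apply: eq_bigr => l lj; have [llj|jl|/val_inj jl] := ltngtP l j.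
- by rewrite b_below// (ab_below (ltnW llj)).2 !mul0r addr0.
- by rewrite b_above//; ring.
- by rewrite jl eqxx in lj.
Qed.

(** Times above [j] enter as [g l - g j], the clock of the part after the cut starting at the cut.
    Values enter in full: by [big_split_above] the value at the cut and the later increment add
    up. *)
Definition exponent (g M : 'I_n.+1 -> R) : R :=
  A * g j + b j * M j + \sum_l (a' l * (g l - g j) + b' l * M l).

Context {d : measure_display} {V : measurableType d}.

(** [q * 2 ^ q] steps of length 2^-q cover time [q], which is at least [H], so the summit exists and
    is a global grid maximum. [tau] is only claimed to be some grid maximizer, all that
    [skeleton_argmax_cvg] asks for. *)
Lemma split_fun_value m q H (xi : 'I_n.+1 -> V -> R) (s : nat -> V) :
  (0 < H <= q)%N -> (forall l t, H%:R <= t -> x l t < 0) ->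
  (forall l k, walk xi s l k = tilt m l (k%:R / 2 ^+ q)) ->
  exists2 tau : 'I_n.+1 -> nat,
    forall (l : 'I_n.+1) k, (j <= l)%N ->
      tilt m l (k%:R / 2 ^+ q) <= tilt m l ((tau l)%:R / 2 ^+ q) &
    split_fun xi j (A / 2 ^+ q) b (fun l => a' l / 2 ^+ q) b' (q * 2 ^ q) s =
    expR (- exponent (fun l => (tau l)%:R / 2 ^+ q)
                     (fun l => tilt m l ((tau l)%:R / 2 ^+ q))).
Proof.
move=> /andP[H0 Hq] xneg W.
have dy0 k : 0 <= k%:R / 2 ^+ q :> R by rewrite divr_ge0// exprn_ge0.
have dym k k' : (k <= k')%N -> k%:R / 2 ^+ q <= k'%:R / 2 ^+ q :> R.
  by move=> kk'; rewrite ler_wpM2r ?invr_ge0 ?exprn_ge0// ler_nat.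
have W0 l : walk xi s l 0%N = 0 by rewrite W mul0r tilt0.
have neg (l : 'I_n.+1) k : (H * 2 ^ q <= k)%N -> walk xi s l k < walk xi s l 0%N.
  move=> Hk; rewrite W0 W (le_lt_trans (tilt_le _ _ (dy0 k)))// xneg//.
  by rewrite ler_pdivlMr ?exprn_gt0// -natrX -natrM ler_nat.
have HN : (0 < H * 2 ^ q <= q * 2 ^ q)%N by rewrite muln_gt0 H0 expn_gt0 /= leq_mul2r Hq orbT.
have [maxj tN sj] := summit_argmaxn HN (neg j).
set N := (q * 2 ^ q)%N in tN sj *.
set t := argmaxn (walk xi s j) N in maxj tN sj *.
pose r (l : 'I_n.+1) := argmaxn (fun i => walk xi s l (t + i)%N - walk xi s l t) N.
(* Coordinates below [j] also get [t], harmlessly, since their weights are zero. *)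
pose tau (l : 'I_n.+1) := if (j < l)%N then (t + r l)%N else t.
have mono (l : 'I_n.+1) k : (j <= l)%N -> (k <= t)%N -> walk xi s l k <= walk xi s l t.
  move=> jl kt; rewrite !W; apply: tilt_mono jl (dy0 k) (dym _ _ kt) _.
  by rewrite -!W.
have ge0t (l : 'I_n.+1) : (j <= l)%N -> 0 <= walk xi s l t.
  by move=> jl; rewrite -(W0 l); exact: mono.
have maxl (l : 'I_n.+1) k : (j <= l)%N -> walk xi s l k <= walk xi s l (tau l).
  rewrite /tau leq_eqVlt => /orP[/eqP/val_inj <-|jl]; first by rewrite ltnn.
  rewrite jl; apply: (argmaxn_shift_max (H := (H * 2 ^ q)%N)).
  - by case/andP: HN.
  - exact: neg.
  - by move=> i; apply: mono; exact: ltnW.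
exists tau; first by move=> l k jl; rewrite -!W maxl.
rewrite split_funE (sum_summit _ (k := Ordinal tN) sj) /split_term /=.
have bW : 0 <= \sum_l b l * walk xi s l t.
  apply: sumr_ge0 => l _; have [lj|jl] := ltnP l j; first by rewrite b_below// mul0r.
  by rewrite mulr_ge0// ge0t.
have q0 : 0 <= (2 ^+ q)^-1 :> R by rewrite invr_ge0 exprn_ge0.
have tauE (l : 'I_n.+1) : (j < l)%N -> tau l = (t + r l)%N by rewrite /tau => ->.
rewrite !nexpE; last 2 first.
- apply: sumr_ge0 => l _; have [lj|jl] := leqP l j.
    by have [-> ->] := ab_below lj; rewrite !mul0r addr0.
  apply: addr_ge0; first by rewrite !mulr_ge0.
  apply: mulr_ge0 => //; rewrite subr_ge0 -/(r l) -tauE// maxl//; exact: ltnW.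
- by rewrite addr_ge0// !mulr_ge0.
rewrite -expRD -opprD; congr (expR (- _)).
have tj : tau j = t by rewrite /tau ltnn.
rewrite /exponent !big_split /= tj.
have -> : \sum_l a' l * ((tau l)%:R / 2 ^+ q - t%:R / 2 ^+ q) =
    \sum_l a' l / 2 ^+ q * (r l)%:R.
  apply: eq_bigr => l _; have [lj|jl] := leqP l j.
    by have [-> _] := ab_below lj; rewrite !mul0r.
  by rewrite tauE// natrD; ring.
have -> : \sum_l b' l * (walk xi s l (t + r l)%N - walk xi s l t) =
    \sum_l b' l * (walk xi s l (tau l) - walk xi s l t).
  apply: eq_bigr => l _; have [lj|jl] := leqP l j.
    by have [_ ->] := ab_below lj; rewrite !mul0r.
  by rewrite tauE.
have -> : \sum_l b' l * tilt m l ((tau l)%:R / 2 ^+ q) = \sum_l b' l * walk xi s l (tau l).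
  by apply: eq_bigr => l _; rewrite W.
have := big_split_above (walk xi s ^~ t) (fun l => walk xi s l (tau l)).
have -> : A / 2 ^+ q * t%:R = A * (t%:R / 2 ^+ q) by ring.
rewrite W /=; lra.
Qed.

(** [exponent] is linear in times and values; the factor 2 appears because both [g l] and [g j]
    move. *)
Lemma exponent_dist (g M g' M' : 'I_n.+1 -> R) (e : R) :
  (forall l : 'I_n.+1, (j <= l)%N -> `|g l - g' l| <= e /\ `|M l - M' l| <= e) ->
  `|exponent g M - exponent g' M'| <=
    e * (A + b j + \sum_l (2 * a' l + b' l)).
Proof.
move=> gM; have [gj Mj] := gM j (leqnn j).
have -> : exponent g M - exponent g' M' = A * (g j - g' j) + b j * (M j - M' j) +
    \sum_l (a' l * ((g l - g' l) - (g j - g' j)) + b' l * (M l - M' l)).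
  rewrite /exponent.
  have -> : \sum_l (a' l * ((g l - g' l) - (g j - g' j)) + b' l * (M l - M' l)) =
      \sum_l (a' l * (g l - g j) + b' l * M l) -
      \sum_l (a' l * (g' l - g' j) + b' l * M' l).
    by rewrite -sumrB; apply: eq_bigr => l _; ring.
  ring.
have -> : e * (A + b j + \sum_l (2 * a' l + b' l)) =
    A * e + b j * e + \sum_l (a' l * (e + e) + b' l * e).
  by rewrite mulrDr mulr_sumr mulrDr; congr (_ + _ + _);
    [ring|ring|apply: eq_bigr => l _; ring].
apply: (le_trans (ler_normD _ _)); apply: lerD.
  apply: (le_trans (ler_normD _ _)).
  by rewrite !normrM (ger0_norm A0) (ger0_norm (b0 j)) lerD// ler_wpM2l.
apply: (le_trans (ler_norm_sum _ _ _)); apply: ler_sum => l _.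
have [lj|jl] := leqP l j; first by have [-> ->] := ab_below lj; rewrite !mul0r addr0 normr0.
have [gl Ml] := gM l (ltnW jl).
apply: (le_trans (ler_normD _ _)).
rewrite !normrM (ger0_norm (a'0 l)) (ger0_norm (b'0 l)) lerD// ler_wpM2l//.
by apply: (le_trans (ler_normB _ _)); exact: lerD.
Qed.

Lemma split_fun_cvg (e : R) : 0 < e ->
  iter_near (fun m q => forall (xi : 'I_n.+1 -> V -> R) (s : nat -> V),
    (forall l k, walk xi s l k = tilt m l (k%:R / 2 ^+ q)) ->
    `|split_fun xi j (A / 2 ^+ q) b (fun l => a' l / 2 ^+ q) b' (q * 2 ^ q) s -
      expR (- exponent (fun l => path_argsup (x l)) (fun l => path_sup (x l)))| <= e).
Proof.
move=> e0; set z0 := exponent _ _.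
have [H [H0 xneg]] := network_negative.
have [eta eta0 hexp] : exists2 eta : R, 0 < eta &
    forall z : R, `|z - z0| <= eta -> `|expR (- z) - expR (- z0)| <= e.
  have := @continuous_expR R (- z0); move/cvgrPdist_le/(_ e e0).
  move=> /nbhs_ballP[r /= r0 hr]; exists (r / 2); first by rewrite divr_gt0.
  move=> z zz; rewrite distrC; apply: hr; rewrite /ball /= opprK addrC.
  by apply: le_lt_trans zz _; rewrite ltr_pdivrMr// ltr_pMr// ltr1n.
(* The final 1 keeps [C] positive when all weights vanish. *)
pose C := A + b j + \sum_l (2 * a' l + b' l) + 1.
have C0 : 0 < C.
  rewrite ltr_wpDl// addr_ge0//; first by rewrite addr_ge0.
  by apply: sumr_ge0 => l _; rewrite addr_ge0// mulr_ge0.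
have d0 : 0 < eta / C by rewrite divr_gt0.
have := iter_near_forall (fun l => skeleton_argmax_cvg (xc l) (xoo l) (Kprod_gt0 K0 ord0 l) d0).
move=> h; apply: (filterS _ h) => m hm {h}.
near=> q => xi s W.
have Hq : (0 < H <= q)%N by rewrite H0; near: q; exact: nbhs_infty_ge.
have [tau maxtau ->] := split_fun_value Hq xneg W.
apply: hexp; apply: le_trans (_ : eta / C * (C - 1) <= _); last first.
  rewrite mulrBr mulr1 divfK ?gt_eqF// gerBl; exact: ltW.
rewrite /C addrK; apply: exponent_dist => l jl.
have hq : forall i : 'I_n.+1, forall k : nat, (forall k' : nat,
    tilt m i (k'%:R / 2 ^+ q) <= tilt m i (k%:R / 2 ^+ q)) ->
    `|k%:R / 2 ^+ q - path_argsup (x i)| <= eta / C /\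
    `|tilt m i (k%:R / 2 ^+ q) - path_sup (x i)| <= eta / C.
  by near: q.
by apply: hq => k; exact: maxtau.
Unshelve. all: by end_near. Qed.

End network_path.

(** * The factorization at one level *)

Lemma borel_measurable {R : realType} (A : set R) : borel A -> measurable A.
Proof.
apply: smallest_sub; first exact: sigma_algebra_measurable.
by move=> B oB; exact: open_measurable.
Qed.

Section sigma_process_facts.
Context {d : measure_display} {T : measurableType d} {R : realType}.

Lemma sigma_process_setI_closed (Y : R -> T -> R) : setI_closed (sigma_process Y).
Proof.
move=> A B sA sB.
exact: (@measurableI _ (g_sigma_algebraType
  (\bigcup_(t in [set t : R | 0 <= t]) sigma_rv (Y t))) A B).
Qed.

Lemma sigma_process_setT (Y : R -> T -> R) : sigma_process Y setT.
Proof.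
exact: (@measurableT _ (g_sigma_algebraType
  (\bigcup_(t in [set t : R | 0 <= t]) sigma_rv (Y t)))).
Qed.

Lemma sigma_process_preimage (Y : R -> T -> R) (t : R) (A : set R) :
  0 <= t -> measurable A -> sigma_process Y (Y t @^-1` A).
Proof.
move=> t0 mA; apply: sub_sigma_algebra; exists t => //.
by exists A; [exact: measurable_borel|rewrite setTI].
Qed.

Lemma sigma_process_measurable (Y : R -> T -> R) :
  (forall t : R, 0 <= t -> measurable_fun setT (Y t)) ->
  sigma_process Y `<=` measurable.
Proof.
move=> mY; apply: smallest_sub; first exact: sigma_algebra_measurable.
move=> _ [t t0 [A bA <-]]; apply: mY => //; exact: borel_measurable.
Qed.

End sigma_process_facts.

Section ae_finite.
Context {d : measure_display} {T : measurableType d} {R : realType}.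
Variable P : probability T R.

Lemma ae_forall_fin (I : finType) (A : I -> T -> Prop) :
  (forall i, {ae P, forall w, A i w}) -> {ae P, forall w, forall i, A i w}.
Proof.
by move=> hA; exact: (@filter_forall T I A (almost_everywhere P) _ hA).
Qed.

Lemma EE_scale (f : T -> R) (c : R) : unit_rv f -> 0 <= c ->
  EE P (fun w => f w * c) = EE P f * c.
Proof.
move=> uf c0; rewrite {1}/EE unlock; under eq_integral do rewrite EFinM.
rewrite ge0_integralZr//; last 2 first.
- by apply/measurable_EFinP; case: uf.
- by move=> w _; rewrite lee_fin unit_rv_ge0.
by rewrite -EE_fin.
Qed.

End ae_finite.

Section network.
Context {d : measure_display} {T : measurableType d} {R : realType}.
Context {P : probability T R} {n : nat} (X : R -> T -> 'rV[R]_n.+1).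
Context (K : 'I_n.+1 -> R) (Ups : 'I_n.+1 -> R -> T -> R).
Let x (k : 'I_n.+1) (w : T) : R -> R := fun t => X t w 0 k.
Hypothesis lX : levy_process P X.
Hypothesis Xoo : forall k, {ae P, forall w, x k w t @[t --> +oo] --> -oo}.
Hypothesis K0 : forall k : 'I_n.+1, (0 < k)%N -> 0 < K k.
Hypothesis sU : forall k : 'I_n.+1, (0 < k)%N -> subordinator P (Ups k).
Hypothesis XU : forall j k : 'I_n.+1, k = j.+1 :> nat ->
  {ae P, forall w, forall t, 0 <= t -> x k w t = K k * x j w t + Ups k t w}.
Hypothesis Xind : mutually_independent P (fun k : 'I_n.+1 =>
    sigma_process (if k == ord0 then (fun t w => x ord0 w t) else Ups k)).

(** The pathwise conditions on one almost sure event, so that the deterministic results apply at a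
    fixed [w]. *)
Record network_paths (w : T) : Prop := {
  np_cadlag : forall k, cadlag (x k w : R -> R^o);
  np_oo : forall k, x k w t @[t --> +oo] --> -oo;
  np_start : X 0 w = 0;
  np_rel : forall j k : 'I_n.+1, k = j.+1 :> nat ->
    forall t : R, 0 <= t -> x k w t = K k * x j w t + Ups k t w;
  np_mono : forall k : 'I_n.+1, (0 < k)%N ->
    forall s t : R, 0 <= s -> s <= t -> Ups k s w <= Ups k t w;
  np_ge0 : forall k : 'I_n.+1, (0 < k)%N ->
    forall t : R, 0 <= t -> 0 <= Ups k t w }.

Lemma network_paths_ae : {ae P, forall w, network_paths w}.
Proof.
have ae_impl (A : 'I_n.+1 -> Prop) (B : 'I_n.+1 -> T -> Prop) :
    (forall k, A k -> {ae P, forall w, B k w}) ->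
    {ae P, forall w, forall k, A k -> B k w}.
  move=> h; apply: ae_forall_fin => k.
  have [Ak|nAk] := pselect (A k); last by apply: nearW => w.
  by apply: filterS (h k Ak).
have h1 := levy_cadlag lX.
have h2 := ae_forall_fin Xoo.
have h3 := levy_start lX.
have h4 := ae_forall_fin (fun j : 'I_n.+1 => ae_impl _ _ (@XU j)).
have h5 : {ae P, forall w, forall k : 'I_n.+1, (0 < k)%N ->
    forall s t : R, 0 <= s -> s <= t -> Ups k s w <= Ups k t w}.
  by apply: ae_impl => k k0; exact: (sU k0).2.
have h6 : {ae P, forall w, forall k : 'I_n.+1, (0 < k)%N ->
    forall t : R, 0 <= t -> 0 <= Ups k t w}.
  by apply: ae_impl => k k0; exact: subordinator_ge0 (sU k0).
near=> w; split.
- move=> k; have [cr cl] : cadlag (X ^~ w) by near: w.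
  split => [t t0|t t0].
    exact: (cvg_comp _ _ (cr t t0) (@coord_continuous R 1 n.+1 0 k (X t w))).
  have [l hl] := cl t t0; exists (l 0 k).
  exact: (cvg_comp _ _ hl (@coord_continuous R 1 n.+1 0 k l)).
- by near: w.
- by near: w.
- by near: w.
- by near: w.
- by near: w.
Unshelve. all: by end_near. Qed.

Definition drifted_step m q (l : 'I_n.+1)
    (v : g_sigma_algebraType (@coordinate_sets R n)) : R :=
  (v : 'rV[R]_n.+1) 0 l - Kprod K ord0 l / m.+1%:R * 2 ^- q.

Definition grid_path q (w : T) (i : nat) : g_sigma_algebraType (@coordinate_sets R n) :=
  increment X (2 ^- q) i w.

Let y m w := tilt (fun k => x k w) K m.

Lemma walk_tilt m q w : X 0 w = 0 -> forall l k,
  walk (drifted_step m q) (grid_path q w) l k = y m w l (k%:R / 2 ^+ q).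
Proof.
move=> Xw l; elim=> [|k IH].
  by rewrite /walk big_ord0 /y /tilt mul0r mulr0 subr0 /x Xw mxE.
rewrite /walk big_ord_recr /= -/(walk _ _ _ _) IH /drifted_step /grid_path.
rewrite /increment !mxE /y /tilt /x -natr1; ring.
Qed.

Lemma measurable_drifted_step m q l : measurable_fun setT (drifted_step m q l).
Proof. by apply: measurable_funB => //; exact: measurable_coordinate. Qed.

Variable j : 'I_n.+1.

Definition skeleton_rv m q (A : R) (b a' b' : 'I_n.+1 -> R) (w : T) : R :=
  split_fun (drifted_step m q) j (A / 2 ^+ q) b (fun l => a' l / 2 ^+ q) b' (q * 2 ^ q)
    (grid_path q w).

Let hq0 q : 0 <= 2 ^- q :> R. Proof. by rewrite invr_ge0 exprn_ge0. Qed.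

Let mZ q := measurable_increment lX (hq0 q).
Let Zind q := increment_indep lX (hq0 q).
Let Zst q := increment_stationary lX (hq0 q).

Lemma unit_rv_skeleton m q A b a' b' : unit_rv (skeleton_rv m q A b a' b').
Proof. exact: (unit_rv_split (mZ q) j (measurable_drifted_step m q)). Qed.

Lemma skeleton_exchange m q A1 b1 A2 b2 a' b' a'' b'' :
  EE P (skeleton_rv m q A1 b1 a' b') * EE P (skeleton_rv m q A2 b2 a'' b'') =
  EE P (skeleton_rv m q A1 b1 a'' b'') * EE P (skeleton_rv m q A2 b2 a' b').
Proof.
exact: (EE_split_exchange (mZ q) (Zind q) (Zst q) j (measurable_drifted_step m q)).
Qed.

Definition limit_rv (A : R) (b a' b' : 'I_n.+1 -> R) (w : T) : R :=
  expR (- exponent j A b a' b' (fun l => path_argsup (x l w)) (fun l => path_sup (x l w))).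

Lemma skeleton_cvg_ae A b a' b' :
  0 <= A -> (forall l, 0 <= b l) -> (forall l, 0 <= a' l) -> (forall l, 0 <= b' l) ->
  (forall l : 'I_n.+1, (l < j)%N -> b l = 0) ->
  (forall l : 'I_n.+1, (j < l)%N -> b l = b' l) ->
  (forall l : 'I_n.+1, (l <= j)%N -> a' l = 0 /\ b' l = 0) ->
  {ae P, forall w, forall e : R, 0 < e ->
    iter_near (fun m q => `|skeleton_rv m q A b a' b' w - limit_rv A b a' b' w| <= e)}.
Proof.
move=> A0 b0 a'0 b'0 b1 b2 b3.
apply: filterS network_paths_ae => w gw r r0.
have x00 k : x k w 0 = 0 by rewrite /x (np_start gw) mxE.
have := @split_fun_cvg R n (fun k => x k w) (fun k t => Ups k t w) K K0
  (np_cadlag gw) (np_oo gw) x00 (np_rel gw) (np_mono gw) j A b a' b'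
  A0 b0 a'0 b'0 b1 b2 b3 _ (g_sigma_algebraType (@coordinate_sets R n)) r r0.
apply: filterS => m; apply: filterS => q; apply; exact: walk_tilt (np_start gw).
Qed.

(** Positivity goes through a measurable version, because [limit_rv] is not known to be
    measurable. *)
Lemma EE_skeleton_cvg A b a' b' :
  0 <= A -> (forall l, 0 <= b l) -> (forall l, 0 <= a' l) -> (forall l, 0 <= b' l) ->
  (forall l : 'I_n.+1, (l < j)%N -> b l = 0) ->
  (forall l : 'I_n.+1, (j < l)%N -> b l = b' l) ->
  (forall l : 'I_n.+1, (l <= j)%N -> a' l = 0 /\ b' l = 0) ->
  0 < EE P (limit_rv A b a' b') /\ forall e : R, 0 < e ->
  iter_near (fun m q =>
    `|EE P (skeleton_rv m q A b a' b') - EE P (limit_rv A b a' b')| <= e).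
Proof.
move=> A0 b0 a'0 b'0 b1 b2 b3.
have h := skeleton_cvg_ae A0 b0 a'0 b'0 b1 b2 b3.
have u m q := unit_rv_skeleton m q A b a' b'.
have pos w : 0 < limit_rv A b a' b' w by exact: expR_gt0.
split => [|e e0].
  by have [Q1 uQ1 Q1E] := unit_rv_version u h; exact: EE_gt0 uQ1 pos Q1E.
by apply: EE_iter_cvg => // w; exact: ltW.
Qed.

(** * Integrating out the subordinators above level j *)

Let source (i : 'I_n.+1) : R -> T -> R :=
  if i == ord0 then (fun t w => x ord0 w t) else Ups i.

Lemma measurable_source i (t : R) : 0 <= t -> measurable_fun setT (source i t).
Proof.
rewrite /source; case: eqP => [_|/eqP i0] t0.
  exact: (@levy_measurable_coord _ _ _ P n X t ord0 lX t0).
by apply: measurable_subordinator t0; apply: sU; rewrite lt0n.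
Qed.

(** The coefficient of subordinator [i] once the coordinates from [i] on are unrolled; it becomes
    the argument of [theta]. *)
Definition laplace_weight (b : 'I_n.+1 -> R) (i : 'I_n.+1) : R :=
  \sum_(l < n.+1 | (i <= l)%N) Kprod K i l * b l.

Definition theta_above (b : 'I_n.+1 -> R) : R :=
  \sum_(i < n.+1 | (j < i)%N) theta P (Ups i) (laplace_weight b i).

Definition at_level (r : R) (l : 'I_n.+1) : R := if l == j then r else 0.

Lemma sum_at_level (r : R) (f : 'I_n.+1 -> R) :
  \sum_l at_level r l * f l = r * f j.
Proof.
rewrite (bigD1 j) //= big1 ?addr0 /at_level ?eqxx// => i /negbTE ->.
by rewrite mul0r.
Qed.

Lemma laplace_weight_ge0 b i : (forall l, 0 <= b l) -> 0 <= laplace_weight b i.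
Proof.
by move=> b0; apply: sumr_ge0 => l _; rewrite mulr_ge0// ltW// Kprod_gt0.
Qed.

(** Each coordinate is unrolled down to [j], then the sums over coordinates and over subordinators
    are exchanged. *)
Lemma weighted_tilt m w b (t : R) : network_paths w -> 0 <= t ->
  (forall l : 'I_n.+1, (l < j)%N -> b l = 0) ->
  \sum_l b l * y m w l t = laplace_weight b j * y m w j t +
    \sum_(i < n.+1 | (j < i)%N) laplace_weight b i * Ups i t w.
Proof.
move=> gw t0 b_below.
transitivity (\sum_(l < n.+1 | (j <= l)%N) b l * y m w l t).
  rewrite [RHS]big_mkcond; apply: eq_bigr => l _.
  by case: leqP => // /b_below ->; rewrite mul0r.
transitivity (\sum_(l < n.+1 | (j <= l)%N) (Kprod K j l * b l * y m w j t +
    \sum_(i < n.+1 | (j < i <= l)%N) Kprod K i l * b l * Ups i t w)).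
  apply: eq_bigr => l jl.
  rewrite /y (@tilt_decomp _ _ (fun k => x k w) (fun k t => Ups k t w) K (np_rel gw) m j l t jl t0).
  rewrite mulrDr mulr_sumr; congr (_ + _); first by ring.
  by apply: eq_bigr => i _; ring.
rewrite big_split /= -mulr_suml; congr (_ + _).
rewrite (exchange_big_dep (fun i : 'I_n.+1 => (j < i)%N)) /=; last by move=> l i _ /andP[].
apply: eq_bigr => i ji; rewrite /laplace_weight mulr_suml; apply: eq_bigl => l.
by rewrite ji /=; case: (leqP i l) => il; rewrite ?andbF// (leq_trans (ltnW ji) il).
Qed.

(** A strict record is at least the starting value 0, so on the summit event the truncation in
    [nexp] is inactive. *)
Lemma summit_ge0 m q w N k : network_paths w ->
  summit N (fun i => y m w j (i%:R / 2 ^+ q)) k -> 0 <= y m w j (k%:R / 2 ^+ q).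
Proof.
move=> gw /andP[/forallP rk _].
have y0 : y m w j (0%:R / 2 ^+ q) = 0.
  by rewrite mul0r /y /tilt mulr0 subr0 /x (np_start gw) mxE.
case: k rk => [|k] rk; first by rewrite y0.
by rewrite -y0; have := rk ord0; exact: ltW.
Qed.

Section one_step.
Variables (m q k : nat) (A : R) (b : 'I_n.+1 -> R).
Hypotheses (A0 : 0 <= A) (b0 : forall l, 0 <= b l)
  (b_below : forall l : 'I_n.+1, (l < j)%N -> b l = 0).

Let N := (q * 2 ^ q)%N.
Let t : R := k%:R / 2 ^+ q.
Let t0 : 0 <= t. Proof. by rewrite divr_ge0// exprn_ge0. Qed.

(* Coordinate j of the tilted network rebuilt from the independent sources, so
   that it is measurable with respect to the sources up to level j only. *)
Let level_path (w : T) (i : nat) : R :=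
  Kprod K ord0 j * source ord0 (i%:R / 2 ^+ q) w +
  \sum_(i' < n.+1 | (0 < i' <= j)%N) Kprod K i' j * source i' (i%:R / 2 ^+ q) w -
  Kprod K ord0 j / m.+1%:R * (i%:R / 2 ^+ q).

Let level_pathE w : network_paths w ->
  level_path w = fun i => y m w j (i%:R / 2 ^+ q).
Proof.
move=> gw; apply/funext => i.
have ti : 0 <= i%:R / 2 ^+ q :> R by rewrite divr_ge0// exprn_ge0.
rewrite /y /tilt (@network_decomp _ _ (fun k => x k w) (fun k t => Ups k t w) K (np_rel gw)
  ord0 j _ (leq0n j) ti).
congr (_ + _ - _); apply: eq_bigr => i' /andP[i'0 _].
by rewrite /source; case: eqP => // i'E; rewrite i'E in i'0.
Qed.

Let below : {set 'I_n.+1} := [set i : 'I_n.+1 | (i <= j)%N]%SET.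
Let S := g_sigma_algebraType (joint_sets (fun i => sigma_process (source i)) below).

Let measurable_level_path i : measurable_fun setT ((fun w => level_path w i) : S -> R).
Proof.
have ti : 0 <= i%:R / 2 ^+ q :> R by rewrite divr_ge0// exprn_ge0.
have ms (i' : 'I_n.+1) : (i' <= j)%N -> measurable_fun setT (source i' (i%:R / 2 ^+ q) : S -> R).
  move=> i'j _ B mB; rewrite setTI; apply: sub_sigma_algebra; exists i'.
    by rewrite /= inE.
  exact: sigma_process_preimage.
apply: measurable_funB => //; apply: measurable_funD.
  by apply: measurable_funM => //; exact: ms.
apply: measurable_condsum => i' /andP[_ i'j].
by apply: measurable_funM => //; exact: ms.
Qed.

Let B := laplace_weight b j.
Let B0 : 0 <= B. Proof. exact: laplace_weight_ge0. Qed.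

Let core (w : T) : R := (summit N (level_path w) k)%:R * nexp (A * t + B * level_path w k).

Let measurable_core : measurable_fun setT (core : S -> R).
Proof.
have ml i : (i <= k + N)%N -> measurable_fun setT ((fun w => level_path w i) : S -> R).
  by move=> _; exact: measurable_level_path.
apply: measurable_funM.
  apply: measurable_bool_natr; apply: measurable_and.
    by apply: (@measurable_strict_record _ _ _ _ _ ml); exact: leq_addr.
  by apply: (@measurable_peak _ _ _ _ _ ml).
by apply: measurable_nexp; apply: measurable_funD => //; apply: measurable_funM.
Qed.

Let core_itv w : 0 <= core w <= 1.
Proof. exact: unit_itvM (bool_itv _) (nexp_itv _). Qed.

Let above : seq 'I_n.+1 := [seq i : 'I_n.+1 <- enum 'I_n.+1 | (j < i)%N].

Let factor (i : 'I_n.+1) (w : T) : R := nexp (laplace_weight b i * source i t w).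

Let sourceE (i : 'I_n.+1) : (0 < i)%N -> source i = Ups i.
Proof. by rewrite /source; case: eqP => // ->. Qed.

(** [core] involves the sources up to [j] only. As [t] is deterministic and dyadic, every source
    above [j] contributes its Laplace transform through [laplace_dyadic]. *)
Lemma core_indep : EE P (fun w => core w * \prod_(i <- above) factor i w) =
  EE P core * expR (- (theta_above b * t)).
Proof.
rewrite (@EE_indep_prod _ _ _ P _ (fun i => sigma_process (source i)) _ _ _ _ above below) //.
- congr (_ * _); rewrite /above big_filter big_enum_cond /= /theta_above mulr_suml -sumrN expR_sum.
  apply: eq_bigr => i ji; have i0 : (0 < i)%N by exact: leq_ltn_trans ji.
  have bi := laplace_weight_ge0 i b0.
  by rewrite /factor (sourceE i0) -(laplace_nexp (sU i0) bi t0) (laplace_dyadic (sU i0) bi).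
- by move=> i; apply: sigma_process_measurable => t'; exact: measurable_source.
- by move=> i; exact: sigma_process_setI_closed.
- by move=> i; exact: sigma_process_setT.
- exact: filter_uniq (enum_uniq _).
- by move=> i; rewrite mem_filter inE -ltnNge => /andP[].
- move=> i C _ mC.
  have mn : measurable_fun setT (fun z : R => nexp (laplace_weight b i * z)).
    by apply: measurable_nexp; exact: measurable_funM.
  have := @sigma_process_preimage _ T R (source i) t _ t0 (mn measurableT _ mC).
  by rewrite setTI.
- by move=> i w; exact: nexp_itv.
Qed.

Let skel A' b' (w : T) : R :=
  pre_fun (drifted_step m q) j (A' / 2 ^+ q) b' k (grid_path q w) *
  post_fun (drifted_step m q) j (fun l => 0 / 2 ^+ q) (fun=> 0) N
    (fun i => grid_path q w (k + i)%N).

Let skelE A' b' w : network_paths w -> skel A' b' w =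
  (summit N (level_path w) k)%:R * nexp (A' * t + \sum_l b' l * y m w l t).
Proof.
move=> gw; rewrite /skel pre_post_summit /split_term.
rewrite [X in _ * (_ * nexp X) = _]big1; last by move=> l _; rewrite !mul0r addr0.
rewrite [nexp 0]nexpE// oppr0 expR0 mulr1 (level_pathE gw).
have wE l : walk (drifted_step m q) (grid_path q w) l = fun i => y m w l (i%:R / 2 ^+ q).
  by apply/funext => i; exact: walk_tilt (np_start gw) l i.
congr ((summit N _ k)%:R * nexp (_ + _)).
- exact: wE.
- by rewrite /t; ring.
- by apply: eq_bigr => l _; rewrite wE.
Qed.

(** Both sides are the mean of [core] times exp(-theta_above t): on the left after integrating out
    the sources above [j], on the right because that constant is already in the weight of time. *)
Lemma skeleton_step :
  EE P (skel A b) = EE P (skel (A + theta_above b) (at_level B)).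
Proof.
have skel0 A' b' w : 0 <= skel A' b' w.
  by case/andP: (unit_itvM (pre_fun_itv (drifted_step m q) j (A' / 2 ^+ q) b' k (grid_path q w))
    (post_fun_itv (drifted_step m q) j (fun l => 0 / 2 ^+ q) (fun=> 0) N
       (fun i => grid_path q w (k + i)%N))).
have th0 : 0 <= theta_above b.
  apply: sumr_ge0 => i ji; apply: theta_ge0; last exact: laplace_weight_ge0.
  by apply: sU; exact: leq_ltn_trans ji.
have core0 w : 0 <= core w by case/andP: (core_itv w).
have -> : EE P (skel A b) = EE P (fun w => core w * \prod_(i <- above) factor i w).
  apply: EE_ae => // [w|].
    by rewrite mulr_ge0// prodr_ge0// => i _; exact: expR_ge0.
  apply: filterS network_paths_ae => w gw; rewrite skelE// /core.
  case: (boolP (summit N (level_path w) k)) => [sk|_]; last by rewrite !mul0r.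
  rewrite !mul1r (weighted_tilt m gw t0 b_below) (level_pathE gw).
  have yj0 : 0 <= y m w j t by apply: (@summit_ge0 m q w N k gw); rewrite -(level_pathE gw).
  have Ui (i : 'I_n.+1) : (j < i)%N -> 0 <= laplace_weight b i * Ups i t w.
    move=> ji; rewrite mulr_ge0 ?laplace_weight_ge0//.
    by apply: (np_ge0 gw) => //; exact: leq_ltn_trans ji.
  rewrite !nexpE; last 2 first.
  - by rewrite addr_ge0// mulr_ge0.
  - by rewrite !addr_ge0 ?mulr_ge0// sumr_ge0.
  rewrite addrA opprD expRD; congr (_ * _).
  rewrite -sumrN expR_sum /above big_filter big_enum_cond /=.
  apply: eq_bigr => i ji; rewrite /factor (sourceE (leq_ltn_trans _ ji))//.
  by rewrite nexpE// Ui.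
rewrite core_indep -EE_scale ?expR_ge0//; last first.
  split => //.
  have mc := measurable_core; move=> _ C mC; rewrite setTI.
  have := mc measurableT _ mC; rewrite setTI; apply: joint_sets_measurable.
  by move=> i; apply: sigma_process_measurable => t'; exact: measurable_source.
apply: EE_ae => // [w|].
  by rewrite mulr_ge0// expR_ge0.
apply: filterS network_paths_ae => w gw; rewrite skelE// /core sum_at_level.
case: (boolP (summit N (level_path w) k)) => [sk|_]; last by rewrite !mul0r.
rewrite !mul1r (level_pathE gw).
have yj0 : 0 <= y m w j t by apply: (@summit_ge0 m q w N k gw); rewrite -(level_pathE gw).
rewrite !nexpE; last 2 first.
- by rewrite !addr_ge0 ?mulr_ge0// addr_ge0.
- by rewrite addr_ge0// mulr_ge0.
by rewrite -expRD; congr expR; rewrite /t; ring.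
Qed.

End one_step.

Lemma skeleton_integrate m q A b : 0 <= A -> (forall l, 0 <= b l) ->
  (forall l : 'I_n.+1, (l < j)%N -> b l = 0) ->
  EE P (skeleton_rv m q A b (fun=> 0) (fun=> 0)) =
  EE P (skeleton_rv m q (A + theta_above b) (at_level (laplace_weight b j))
          (fun=> 0) (fun=> 0)).
Proof.
move=> A0 b0 b_below; rewrite /skeleton_rv /split_fun.
have u A' b' k := unit_rv_split_term (mZ q) j (measurable_drifted_step m q)
  (A' / 2 ^+ q) b' (fun l => 0 / 2 ^+ q) (fun=> 0) (q * 2 ^ q) k.
rewrite !EE_sum; last 2 first.
- by move=> k; exact: u.
- by move=> k; exact: u.
by apply: eq_bigr => k _; exact: skeleton_step.
Qed.

(** * Joint and marginal transforms at level j *)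

Section level.
Variables alpha beta : 'I_n.+1 -> R.
Hypotheses (alpha0 : forall l, 0 <= alpha l) (beta0 : forall l, 0 <= beta l).

Definition from_level (f : 'I_n.+1 -> R) (l : 'I_n.+1) : R :=
  if (j <= l)%N then f l else 0.
Definition past_level (f : 'I_n.+1 -> R) (l : 'I_n.+1) : R :=
  if (j < l)%N then f l else 0.

(** The time weight is the sum of all [alpha l] from [j] on, since writing G_l as G_j + (G_l - G_j)
    charges each of them to G_j. *)
Definition joint_rv : T -> R :=
  limit_rv (\sum_(l < n.+1 | (j <= l)%N) alpha l)
    (from_level beta) (past_level alpha) (past_level beta).

Definition marginal_rv : T -> R :=
  limit_rv (\sum_(l < n.+1 | (j <= l)%N) alpha l + theta_above (from_level beta))
    (at_level (laplace_weight (from_level beta) j)) (fun=> 0) (fun=> 0).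

Lemma from_level_ge0 f l : (forall i, 0 <= f i) -> 0 <= from_level f l.
Proof. by move=> f0; rewrite /from_level; case: ifP. Qed.

Lemma past_level_ge0 f l : (forall i, 0 <= f i) -> 0 <= past_level f l.
Proof. by move=> f0; rewrite /past_level; case: ifP. Qed.

Lemma theta_above_ge0 b : (forall l, 0 <= b l) -> 0 <= theta_above b.
Proof.
move=> b0; apply: sumr_ge0 => i ji; apply: theta_ge0; last exact: laplace_weight_ge0.
by apply: sU; exact: leq_ltn_trans ji.
Qed.

Let sum_alpha_ge0 : 0 <= \sum_(l < n.+1 | (j <= l)%N) alpha l.
Proof. exact: sumr_ge0. Qed.

Lemma joint_cvg : 0 < EE P joint_rv /\ forall e : R, 0 < e ->
  iter_near (fun m q => `|EE P (skeleton_rv m q (\sum_(l < n.+1 | (j <= l)%N) alpha l)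
    (from_level beta) (past_level alpha) (past_level beta)) - EE P joint_rv| <= e).
Proof.
apply: EE_skeleton_cvg => // l.
- exact: from_level_ge0.
- exact: past_level_ge0.
- exact: past_level_ge0.
- by move=> lj; rewrite /from_level leqNgt lj.
- by move=> jl; rewrite /from_level /past_level jl ltnW.
- by move=> lj; rewrite /past_level ltnNge lj.
Qed.

(** With zero weights after the cut, [from_level beta] in general breaks the condition of
    [EE_skeleton_cvg] that the weights before and after agree above [j]. [skeleton_integrate] first
    moves all weight to coordinate [j], where the condition holds. *)
Lemma marginal_cvg : 0 < EE P marginal_rv /\ forall e : R, 0 < e ->
  iter_near (fun m q => `|EE P (skeleton_rv m q (\sum_(l < n.+1 | (j <= l)%N) alpha l)
    (from_level beta) (fun=> 0) (fun=> 0)) - EE P marginal_rv| <= e).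
Proof.
have fl l : 0 <= from_level beta l by exact: from_level_ge0.
have [| | | | | | |pos h] := @EE_skeleton_cvg
    (\sum_(l < n.+1 | (j <= l)%N) alpha l + theta_above (from_level beta))
    (at_level (laplace_weight (from_level beta) j)) (fun=> 0) (fun=> 0) => //.
- by rewrite addr_ge0// theta_above_ge0.
- by move=> l; rewrite /at_level; case: ifP => // _; exact: laplace_weight_ge0.
- by move=> l lj; rewrite /at_level; case: eqP => // lE; rewrite lE ltnn in lj.
- by move=> l jl; rewrite /at_level; case: eqP => // lE; rewrite lE ltnn in jl.
split => // e e0; apply: filterS (h e e0) => m; apply: filterS => q.
rewrite -skeleton_integrate// => l lj.
by rewrite /from_level leqNgt lj.
Qed.

Lemma joint_rvE w : joint_rv w =
  expR (- \sum_(l < n.+1 | (j <= l)%N)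
     (alpha l * path_argsup (x l w) + beta l * path_sup (x l w))).
Proof.
congr (expR (- _)); rewrite /exponent /from_level leqnn.
rewrite (bigD1 j) //= [in RHS](bigD1 j) //= mulrDl.
have -> : \sum_l (past_level alpha l * (path_argsup (x l w) - path_argsup (x j w)) +
    past_level beta l * path_sup (x l w)) =
  \sum_(l < n.+1 | (j <= l)%N && (l != j))
    (alpha l * path_argsup (x l w) + beta l * path_sup (x l w)) -
  (\sum_(l < n.+1 | (j <= l)%N && (l != j)) alpha l) * path_argsup (x j w).
  rewrite mulr_suml -sumrB [RHS]big_mkcond /=; apply: eq_bigr => l _.
  rewrite /past_level ltn_neqAle andbC eq_sym (inj_eq val_inj).
  by case: ifP => _; [rewrite mulrBr addrAC|rewrite !mul0r addr0].
ring.
Qed.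

Lemma marginal_rvE w : marginal_rv w =
  expR (- ((\sum_(l < n.+1 | (j <= l)%N) alpha l +
            \sum_(l < n.+1 | (j < l)%N) theta P (Ups l)
               (\sum_(k < n.+1 | (l <= k)%N) Kprod K l k * beta k)) *
           path_argsup (x j w)) -
        (\sum_(l < n.+1 | (j <= l)%N) Kprod K j l * beta l) * path_sup (x j w)).
Proof.
rewrite /marginal_rv /limit_rv /exponent.
rewrite [X in expR (- (_ + X)) = _]big1; last by move=> l _; rewrite !mul0r addr0.
have lw (i : 'I_n.+1) : (j <= i)%N -> laplace_weight (from_level beta) i =
    \sum_(k < n.+1 | (i <= k)%N) Kprod K i k * beta k.
  move=> ji; apply: eq_bigr => k ik.
  by rewrite /from_level (leq_trans ji ik).
have thE : theta_above (from_level beta) = \sum_(l < n.+1 | (j < l)%N) theta P (Ups l)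
    (\sum_(k < n.+1 | (l <= k)%N) Kprod K l k * beta k).
  by apply: eq_bigr => i ji; rewrite (lw i (ltnW ji)).
by rewrite addr0 opprD /at_level eqxx (lw j (leqnn j)) thE.
Qed.

End level.

Lemma iter_near_mul_eq (u1 v1 u2 v2 : nat -> nat -> R) (a1 b1 a2 b2 : R) :
  (forall e : R, 0 < e -> iter_near (fun m q => `|u1 m q - a1| <= e)) ->
  (forall e : R, 0 < e -> iter_near (fun m q => `|v1 m q - b1| <= e)) ->
  (forall e : R, 0 < e -> iter_near (fun m q => `|u2 m q - a2| <= e)) ->
  (forall e : R, 0 < e -> iter_near (fun m q => `|v2 m q - b2| <= e)) ->
  (forall m q, u1 m q * v1 m q = u2 m q * v2 m q) -> a1 * b1 = a2 * b2.
Proof.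
move=> hu1 hv1 hu2 hv2 uv.
have lim_mul (u v : nat -> nat -> R) (a b : R) :
    (forall e : R, 0 < e -> iter_near (fun m q => `|u m q - a| <= e)) ->
    (forall e : R, 0 < e -> iter_near (fun m q => `|v m q - b| <= e)) ->
    forall e : R, 0 < e -> iter_near (fun m q => `|u m q * v m q - a * b| <= e).
  move=> hu hv e e0.
  have C0 : 0 < `|a| + `|b| + 1 by rewrite ltr_wpDl// addr_ge0.
  have [r [r0 r1 rC]] : exists r : R, [/\ 0 < r, r <= 1 & r * (`|a| + `|b| + 1) <= e].
    exists (Num.min 1 (e / (`|a| + `|b| + 1))); split.
    - by rewrite lt_min ltr01 divr_gt0.
    - by rewrite ge_min lexx.
    - by rewrite -ler_pdivlMr// ge_min lexx orbT.
  apply: filterS2 (hu r r0) (hv r r0) => m; apply: filterS2 => q ur vr.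
  have -> : u m q * v m q - a * b =
      (u m q - a) * (v m q - b) + a * (v m q - b) + (u m q - a) * b by ring.
  have t1 : `|(u m q - a) * (v m q - b)| <= r.
    by rewrite normrM -[leRHS]mulr1; apply: ler_pM => //; exact: le_trans r1.
  have t2 : `|a * (v m q - b)| <= r * `|a| by rewrite normrM mulrC ler_wpM2r.
  have t3 : `|(u m q - a) * b| <= r * `|b| by rewrite normrM ler_wpM2r.
  have n1 := ler_normD ((u m q - a) * (v m q - b) + a * (v m q - b)) ((u m q - a) * b).
  have n2 := ler_normD ((u m q - a) * (v m q - b)) (a * (v m q - b)).
  apply: (le_trans n1); apply: (le_trans (lerD n2 (lexx _))).
  apply: (le_trans (lerD (lerD t1 t2) t3)); apply: le_trans rC.
  by rewrite !mulrDr mulr1 -addrA addrC.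
apply/eqP; rewrite -subr_eq0 -normr_le0; apply/ler_addgt0Pr => e e0; rewrite add0r.
have e20 : 0 < e / 2 by rewrite divr_gt0.
have [m] := @filter_ex _ \oo _ _ (filterI (lim_mul _ _ _ _ hu1 hv1 _ e20)
  (lim_mul _ _ _ _ hu2 hv2 _ e20)).
move=> [h1 h2]; have [q [{}h1 {}h2]] := @filter_ex _ \oo _ _ (filterI h1 h2).
rewrite uv in h1; rewrite !ler_norml in h1 h2 *; lra.
Qed.

(** Agreement above [j] means equal weights after the cut, so the exact exchange on every skeleton
    passes to the limit. *)
Lemma level_exchange (alpha beta alpha' beta' : 'I_n.+1 -> R) :
  (forall l, 0 <= alpha l) -> (forall l, 0 <= beta l) ->
  (forall l, 0 <= alpha' l) -> (forall l, 0 <= beta' l) ->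
  (forall l : 'I_n.+1, (j < l)%N -> alpha l = alpha' l /\ beta l = beta' l) ->
  EE P (joint_rv alpha beta) * EE P (marginal_rv alpha' beta') =
  EE P (marginal_rv alpha beta) * EE P (joint_rv alpha' beta').
Proof.
move=> al be al' be' agree.
have pa : past_level alpha = past_level alpha'.
  by apply/funext => l; rewrite /past_level; case: ifP => // /agree[].
have pb : past_level beta = past_level beta'.
  by apply/funext => l; rewrite /past_level; case: ifP => // /agree[].
have [_ h1] := joint_cvg al be; have [_ h2] := marginal_cvg al' be'.
have [_ h3] := marginal_cvg al be; have [_ h4] := joint_cvg al' be'.
apply: iter_near_mul_eq h1 h2 h3 h4 _ => m q.
by rewrite -pa -pb; exact: skeleton_exchange.
Qed.

Lemma level_ratio (alpha beta : 'I_n.+1 -> R) :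
  (forall l, 0 <= alpha l) -> (forall l, 0 <= beta l) ->
  let th (l : 'I_n.+1) :=
    theta P (Ups l) (\sum_(k < n.+1 | (l <= k)%N) Kprod K l k * beta k) in
  EE P (fun w => expR (- \sum_(l < n.+1 | (j <= l)%N)
     (alpha l * path_argsup (x l w) + beta l * path_sup (x l w)))) =
  EE P (fun w => expR
        (- ((\sum_(l < n.+1 | (j <= l)%N) alpha l
             + \sum_(l < n.+1 | (j < l)%N) th l) * path_argsup (x j w))
         - (\sum_(l < n.+1 | (j <= l)%N) Kprod K j l * beta l) * path_sup (x j w))) /
  EE P (fun w => expR
        (- ((\sum_(l < n.+1 | (j < l)%N) alpha l
             + \sum_(l < n.+1 | (j < l)%N) th l) * path_argsup (x j w))
         - (\sum_(l < n.+1 | (j < l)%N) Kprod K j l * beta l) * path_sup (x j w))) *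
  EE P (fun w => expR (- \sum_(l < n.+1 | (j < l)%N)
     (alpha l * path_argsup (x l w) + beta l * path_sup (x l w)))).
Proof.
move=> al be th.
(* With the weights at [j] set to zero, the second marginal transform becomes the denominator and
   the second joint transform that of the levels above [j]. *)
pose al' := past_level alpha; pose be' := past_level beta.
have al'0 l : 0 <= al' l by exact: past_level_ge0.
have be'0 l : 0 <= be' l by exact: past_level_ge0.
have pastE (f g : 'I_n.+1 -> R) : (forall l : 'I_n.+1, (l <= j)%N -> g l = 0) ->
    (forall l : 'I_n.+1, (j < l)%N -> f l = g l) ->
    \sum_(l < n.+1 | (j < l)%N) f l = \sum_(l < n.+1 | (j <= l)%N) g l.
  move=> g0 fg; rewrite big_mkcond [RHS]big_mkcond; apply: eq_bigr => l _.
  by case: ltngtP => [jl|lj|jl]; [exact: fg| |rewrite g0// jl].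
have al'j (l : 'I_n.+1) : (l <= j)%N -> al' l = 0 by move=> lj; rewrite /al' /past_level ltnNge lj.
have be'j (l : 'I_n.+1) : (l <= j)%N -> be' l = 0 by move=> lj; rewrite /be' /past_level ltnNge lj.
have al'E (l : 'I_n.+1) : (j < l)%N -> alpha l = al' l by rewrite /al' /past_level => ->.
have be'E (l : 'I_n.+1) : (j < l)%N -> beta l = be' l by rewrite /be' /past_level => ->.
have key := @level_exchange alpha beta al' be' al be al'0 be'0
  (fun l jl => conj (al'E l jl) (be'E l jl)).
have EJ a b : EE P (joint_rv a b) = EE P (fun w => expR (- \sum_(l < n.+1 | (j <= l)%N)
     (a l * path_argsup (x l w) + b l * path_sup (x l w)))).
  by congr EE; apply/funext => w; exact: joint_rvE.
have EM a b : EE P (marginal_rv a b) = EE P (fun w => expR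
   (- ((\sum_(l < n.+1 | (j <= l)%N) a l + \sum_(l < n.+1 | (j < l)%N) theta P (Ups l)
          (\sum_(k < n.+1 | (l <= k)%N) Kprod K l k * b k)) * path_argsup (x j w)) -
    (\sum_(l < n.+1 | (j <= l)%N) Kprod K j l * b l) * path_sup (x j w))).
  by congr EE; apply/funext => w; exact: marginal_rvE.
have [D0 _] := marginal_cvg al'0 be'0.
have DE : EE P (marginal_rv al' be') = EE P (fun w => expR
        (- ((\sum_(l < n.+1 | (j < l)%N) alpha l
             + \sum_(l < n.+1 | (j < l)%N) th l) * path_argsup (x j w))
         - (\sum_(l < n.+1 | (j < l)%N) Kprod K j l * beta l) * path_sup (x j w))).
  have aE := pastE alpha al' al'j al'E.
  have kE : \sum_(l < n.+1 | (j < l)%N) Kprod K j l * beta l =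
      \sum_(l < n.+1 | (j <= l)%N) Kprod K j l * be' l.
    by apply: pastE => l jl; [rewrite be'j// mulr0|rewrite be'E].
  have tE : \sum_(l < n.+1 | (j < l)%N) th l = \sum_(l < n.+1 | (j < l)%N)
      theta P (Ups l) (\sum_(k < n.+1 | (l <= k)%N) Kprod K l k * be' k).
    apply: eq_bigr => l jl; congr (theta P (Ups l) _).
    by apply: eq_bigr => k lk; rewrite be'E// (leq_trans jl lk).
  by rewrite EM aE kE tE.
have JE : EE P (joint_rv al' be') = EE P (fun w => expR (- \sum_(l < n.+1 | (j < l)%N)
     (alpha l * path_argsup (x l w) + beta l * path_sup (x l w)))).
  rewrite EJ; congr EE; apply/funext => w; congr (expR (- _)); apply/esym/pastE => l lj.
    by rewrite al'j// be'j// !mul0r addr0.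
  by rewrite al'E// be'E.
rewrite -DE -JE -(EM alpha beta) -(EJ alpha beta).
by rewrite mulrAC -key mulfK// gt_eqF.
Qed.

End network.

Theorem theorem3p1 (d : measure_display) (T : measurableType d) (R : realType)
    (P : probability T R) (n : nat) (X : R -> T -> 'rV[R]_n.+1)
    (K : 'I_n.+1 -> R) (Ups : 'I_n.+1 -> R -> T -> R)
    (alpha beta : 'rV[R]_n.+1) :
  let x (k : 'I_n.+1) (w : T) : R -> R := fun t => X t w 0 k in
  let Xbar (k : 'I_n.+1) (w : T) : R := path_sup (x k w) in
  let G (k : 'I_n.+1) (w : T) : R := path_argsup (x k w) in
  let th (l : 'I_n.+1) : R :=
    theta P (Ups l) (\sum_(k < n.+1 | (l <= k)%N) Kprod K l k * beta 0 k) in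
  levy_process P X ->
  (forall k, {ae P, forall w, x k w t @[t --> +oo] --> -oo}) ->
  (forall k : 'I_n.+1, (0 < k)%N -> 0 < K k) ->
  (forall k : 'I_n.+1, (0 < k)%N -> subordinator P (Ups k)) ->
  (forall j k : 'I_n.+1, k = j.+1 :> nat ->
     {ae P, forall w, forall t, 0 <= t ->
        x k w t = K k * x j w t + Ups k t w}) ->
  mutually_independent P (fun k : 'I_n.+1 =>
    sigma_process (if k == ord0 then (fun t w => x ord0 w t) else Ups k)) ->
  (forall k, 0 <= alpha 0 k) ->
  (forall k, 0 <= beta 0 k) ->
  EE P (fun w => expR (- (\sum_k alpha 0 k * G k w)
                       - (\sum_k beta 0 k * Xbar k w))) =
  (\prod_(j < n.+1 | (j < n)%N)
     (EE P (fun w => expR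
        (- ((\sum_(l < n.+1 | (j <= l)%N) alpha 0 l
             + \sum_(l < n.+1 | (j < l)%N) th l) * G j w)
         - (\sum_(l < n.+1 | (j <= l)%N) Kprod K j l * beta 0 l) * Xbar j w)) /
      EE P (fun w => expR
        (- ((\sum_(l < n.+1 | (j < l)%N) alpha 0 l
             + \sum_(l < n.+1 | (j < l)%N) th l) * G j w)
         - (\sum_(l < n.+1 | (j < l)%N) Kprod K j l * beta 0 l) * Xbar j w)))) *
  EE P (fun w => expR (- (alpha 0 ord_max * G ord_max w)
                       - beta 0 ord_max * Xbar ord_max w)).
Proof.
move=> x Xbar G th lX Xoo K0 sU XU Xind alpha0 beta0.
pose ratio (j : 'I_n.+1) : R :=
  EE P (fun w => expR
        (- ((\sum_(l < n.+1 | (j <= l)%N) alpha 0 l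
             + \sum_(l < n.+1 | (j < l)%N) th l) * G j w)
         - (\sum_(l < n.+1 | (j <= l)%N) Kprod K j l * beta 0 l) * Xbar j w)) /
  EE P (fun w => expR
        (- ((\sum_(l < n.+1 | (j < l)%N) alpha 0 l
             + \sum_(l < n.+1 | (j < l)%N) th l) * G j w)
         - (\sum_(l < n.+1 | (j < l)%N) Kprod K j l * beta 0 l) * Xbar j w)).
pose tail (j : nat) : R := EE P (fun w => expR (- \sum_(l < n.+1 | (j <= l)%N)
  (alpha 0 l * G l w + beta 0 l * Xbar l w))).
have step (j : 'I_n.+1) : tail j = ratio j * tail j.+1.
  exact: (level_ratio lX Xoo K0 sU XU Xind j alpha0 beta0).
have tail_last : tail n = EE P (fun w => expR (- (alpha 0 ord_max * G ord_max w)
                                 - beta 0 ord_max * Xbar ord_max w)).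
  congr EE; apply/funext => w; congr expR; rewrite -opprD (big_pred1 ord_max)// => l.
  by rewrite /= -(inj_eq val_inj) /= eqn_leq -[(l <= n)%N]ltnS ltn_ord.
have tail_first : tail 0%N =
    EE P (fun w => expR (- (\sum_k alpha 0 k * G k w) - (\sum_k beta 0 k * Xbar k w))).
  by congr EE; apply/funext => w; congr expR; rewrite -opprD -big_split.
rewrite -tail_first -tail_last.
(* Induction on the number [p] of ratios still to be split off; the last coordinate stays as
   [tail n]. *)
have telescope p j : (j + p)%N = n ->
    tail j = (\prod_(i < n.+1 | (j <= i < n)%N) ratio i) * tail n.
  elim: p j => [|p IH] j.
    rewrite addn0 => ->; rewrite big_pred0 ?mul1r// => i.
    by case: (ltnP i n) => // ni; rewrite andbF.
  rewrite addnS -addSn => jn; have jlt : (j < n)%N by rewrite -jn addSn ltnS leq_addr.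
  pose j' : 'I_n.+1 := Ordinal (ltnW jlt : (j < n.+1)%N).
  rewrite (step j') (IH j.+1 jn) [in RHS](bigD1 j') /=; last by rewrite leqnn jlt.
  rewrite mulrA; congr (_ * _ * _); apply: eq_bigl => i.
  by rewrite -(inj_eq val_inj) /= eq_sym andbAC [(j <= i)%N]leq_eqVlt; case: ltngtP.
by rewrite (telescope n 0%N).
Qed.
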